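(* Let $\kappa$ be an infinite cardinal with $\kappa=\kappa^{<\kappa}$. Then the space $S_\kappa$ is non-reconstructible. Indeed, for every $P_\kappa$-point $p$ of $S_\kappa$, the space $S_\kappa\setminus\{p\}$ is a reconstruction of $S_\kappa$ that is not homeomorphic to $S_\kappa$.
   Context: A space is zero-dimensional if it has a base of clopen sets. A subset $Y$ of a space $X$ is $C^*$-embedded if every bounded real-valued continuous function on $Y$ extends to a continuous real-valued function on $X$. In a zero-dimensional space $X$, the type $\tau(U)$ of an open set $U\subset X$ is the least cardinal $\tau$ such that $U$ is a union of $\tau$ many clopen subsets of $X$. A zero-dimensional space is an $F_\kappa$-space if its open subsets of type less than $\kappa$ are $C^*$-embedded. A $\kappa$-Parovičenko space is a compact Hausdorff zero-dimensional $F_\kappa$-space of weight $\kappa^{<\kappa}$ without isolated points such that every non-empty intersection of fewer than $\kappa$ many open sets has non-empty interior. It is known (Negrepontis) that if $\kappa=\kappa^{<\kappa}$ then there is, up to homeomorphism, exactly one $\kappa$-Parovičenko space; it is denoted $S_\kappa$. A $P_\kappa$-point is a point $p$ such that the intersection of fewer than $\kappa$ many neighbourhoods of $p$ always contains an open neighbourhood of $p$. A space $Y$ is a card of a space $X$ if $Y$ is homeomorphic to $X\setminus\{x\}$ for some $x\in X$. The deck $\mathcal{D}(X)$ is the set of homeomorphism types of cards of $X$. Thus $\mathcal{D}(X)=\mathcal{D}(Z)$ means that for every $x\in X$ there is $z\in Z$ with $X\setminus\{x\}\cong Z\setminus\{z\}$, and for every $z\in Z$ there is $x\in X$ with $Z\setminus\{z\}\cong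 X\setminus\{x\}$. In that case $X$ and $Z$ are called reconstructions of each other. A space $X$ is reconstructible if $\mathcal{D}(X)=\mathcal{D}(Z)$ implies $X\cong Z$ for every space $Z$; otherwise it is non-reconstructible. *)

(* Defs.v *)
From HB Require Import structures.
From mathcomp Require Import all_boot all_order all_algebra.
From mathcomp Require Import all_classical all_reals all_analysis.

Set Implicit Arguments.
Unset Strict Implicit.
Unset Printing Implicit Defensive.

Import Order.TTheory GRing.Theory Num.Theory.
Import numFieldNormedType.Exports.

Local Open Scope classical_set_scope.
Local Open Scope card_scope.
Local Open Scope ring_scope.

(* A cardinal is represented by any type of that cardinality; every notion
   below depends on such a type only up to bijection. *)

Definition cardinal_le (I J : Type) : Prop := [set: I] #<= [set: J].

Definition cardinal_lt (I J : Type) : Prop :=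
  cardinal_le I J /\ ~ cardinal_le J I.

(* [P] has cardinality kappa^{<kappa} = sup {kappa^lambda | lambda < kappa},
   where kappa is the cardinality of [K]. *)
Definition is_weak_power (K P : Type) : Prop :=
  (forall L : Type, cardinal_lt L K -> cardinal_le (L -> K) P) /\
  (forall Q : Type,
     (forall L : Type, cardinal_lt L K -> cardinal_le (L -> K) Q) ->
     cardinal_le P Q).

(* The library's [zero_dimensional] only separates points by clopen sets,
   which is weaker than having a base of clopen sets. *)
Definition has_clopen_base (X : topologicalType) : Prop :=
  exists2 B : set (set X), basis B & B `<=` clopen.

Definition Cstar_embedded (R : realType) (X : topologicalType) (Y : set X) :
    Prop :=
  forall f : set_type Y -> R,
    continuous f -> (exists M : R, forall y, `|f y| <= M) ->
    exists2 g : X -> R, continuous g & forall y : set_type Y, g (\val y) = f y.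

Definition clopen_union_of (X : topologicalType) (U : set X) (I : Type) : Prop :=
  exists2 F : I -> set X, (forall i, clopen (F i)) & U = \bigcup_i F i.

Definition is_open_type (X : topologicalType) (U : set X) (T : Type) : Prop :=
  clopen_union_of U T /\
  forall I : Type, clopen_union_of U I -> cardinal_le T I.

Definition F_space (R : realType) (K : Type) (X : topologicalType) : Prop :=
  has_clopen_base X /\
  forall U : set X, open U ->
    (exists2 T : Type, is_open_type U T & cardinal_lt T K) ->
    Cstar_embedded R U.

Definition is_weight (X : topologicalType) (W : Type) : Prop :=
  (exists2 B : set (set X), basis B & B #= [set: W]) /\
  forall B : set (set X), basis B -> [set: W] #<= B.

Definition Parovicenko (R : realType) (K : Type) (X : topologicalType) : Prop :=
  [/\ compact [set: X] /\ hausdorff_space X,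
      F_space R K X,
      exists2 W : Type, is_weak_power K W & is_weight X W,
      isolated [set: X] = set0 &
      forall (I : Type) (F : I -> set X), cardinal_lt I K ->
        (forall i, open (F i)) -> \bigcap_i F i !=set0 ->
        (\bigcap_i F i)° !=set0].

Definition P_point (K : Type) (X : topologicalType) (p : X) : Prop :=
  forall (I : Type) (F : I -> set X), cardinal_lt I K ->
    (forall i, nbhs p (F i)) ->
    exists2 U : set X, open_nbhs p U & U `<=` \bigcap_i F i.

Definition homeomorphic (X Y : topologicalType) : Prop :=
  exists (f : X -> Y) (g : Y -> X),
    [/\ continuous f, continuous g, cancel f g & cancel g f].

(* [set_type] carries the genuine subspace topology, unlike [subspace]. *)
Definition remove_point (X : topologicalType) (x : X) : topologicalType :=
  set_type [set~ x].

Definition is_card (X Y : topologicalType) : Prop :=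
  exists x : X, homeomorphic Y (remove_point x).

(* Equality of the decks, i.e. of the homeomorphism-closed classes of cards. *)
Definition reconstruction (X Z : topologicalType) : Prop :=
  forall Y : topologicalType, is_card X Y <-> is_card Z Y.

Definition reconstructible (X : topologicalType) : Prop :=
  forall Z : topologicalType, reconstruction X Z -> homeomorphic X Z.

(* Main.v *)
Require Import Defs.
From Stdlib Require Import Inverse_Image.
From HB Require Import structures.
From mathcomp Require Import all_boot all_classical all_reals all_analysis.
From mathcomp Require Import order ssralg ssrnum finmap wochoice.

(** Call a closed set T of S a P-set if it is not open and any fewer than kappa
clopen supersets of T contain a common clopen superset of T; a P_kappa-point is
a P-set.  A back-and-forth of length kappa shows that the complements of any
two P-sets of S are homeomorphic: a stage is a family of pairs of clopen sets,
avoiding the respective P-sets, whose Boolean cells are simultaneously empty;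
it can be extended because fewer than kappa clopen sets on either side can be
separated and every non-empty cell contains two disjoint non-empty clopen sets.

Given a P_kappa-point p and y <> p, a recursion along the clopen neighbourhoods
of y produces a P-set T with y in T, p outside T and T \ {y} open.  Both T and
T u {p} are P-sets, so a homeomorphism between their complements, extended by
the identity on T \ {y}, gives S \ {y} = S \ {y, p} up to homeomorphism.  Since
moreover all the cards S \ {p} at P_kappa-points agree and there is more than
one such point, S and S \ {p} have the same deck; the latter is not compact. *)

Set Implicit Arguments.
Unset Strict Implicit.
Unset Printing Implicit Defensive.

Import Order.TTheory GRing.Theory Num.Theory.
Import numFieldNormedType.Exports.

Local Open Scope classical_set_scope.
Local Open Scope card_scope.

(** * Comparison of cardinals *)

Lemma sval_inj (T : Type) (P : T -> Prop) : injective (@sval T P).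
Proof.
move=> [x Px] [y Py] /= xy; subst y; congr exist; exact: Prop_irrelevance.
Qed.

Lemma cardinal_leP (I J : Type) :
  cardinal_le I J <-> exists f : I -> J, injective f.
Proof.
split=> [/card_leP[f]|[f fi]].
  exists (fun x => val (f (SigSub (mem_set (Logic.I : [set: _] x))))) =>
    x y /val_inj.
  by move=> /inj - /(_ (in_setT _) (in_setT _)) [].
suff [g] : $|{injfun [set: I] >-> [set: J]}| by exact: (inj_card_le g).
by apply/injfunPex; exists f => // x y _ _; exact: fi.
Qed.

Lemma cardinal_le_refl (I : Type) : cardinal_le I I.
Proof. exact: card_lexx. Qed.

Lemma cardinal_le_trans (J I L : Type) :
  cardinal_le I J -> cardinal_le J L -> cardinal_le I L.
Proof. exact: card_le_trans. Qed.

Lemma surj_cardinal_le (I J : Type) (f : J -> I) :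
  (forall i, exists j, f j = i) -> cardinal_le I J.
Proof.
move=> /choice[g gK]; apply/cardinal_leP; exists g; exact: can_inj gK.
Qed.

Lemma cardinal_le_surj (I J : Type) (i0 : I) :
  cardinal_le I J -> exists f : J -> I, forall i, exists j, f j = i.
Proof.
move=> /cardinal_leP[f fi].
have /choice[g gP] : forall j, exists i, forall i', f i' = j -> i = i'.
  move=> j; have [[i <-]|n] := pselect (exists i, f i = j).
    by exists i => i' /fi.
  by exists i0 => i' fi'; case: n; exists i'.
by exists g => i; exists (f i); exact: gP.
Qed.

(* Honig's argument: a maximal family of points of the product whose
   coordinates are pairwise distinct projects onto some factor. *)
Lemma cardinal_min (D : Type) (X : D -> Type) : inhabited D ->
  exists i, forall j, cardinal_le (X i) (X j).
Proof.
move=> [d0].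
pose P (F : set (forall i, X i)) :=
  forall f g i, F f -> F g -> f i = g i -> f = g.
have [F [PF Fmax]] : exists A, P A /\ forall B, A `<` B -> ~ P B.
  apply: Zorn_bigcup => G GP Gtot f g i [A GA Af] [B GB Bg] fgi.
  have [AB|BA] := Gtot _ _ GA GB.
    by apply: (GP _ GB _ _ i) => //; exact: AB.
  by apply: (GP _ GA _ _ i) => //; exact: BA.
(* If [F] exhausted no factor, a point [h] whose coordinates are all missed by [F] could be added to
   [F], against maximality. *)
have [i Fi] : exists i, forall x : X i, exists2 f, F f & f i = x.
  apply: contrapT => nFi.
  have ex i : exists x : X i, forall f, F f -> f i <> x.
    apply: contrapT => nx; apply: nFi; exists i => x.
    apply: contrapT => nf; apply: nx; exists x => f Ff fx; apply: nf.
    by exists f.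
  pose h i := projT1 (cid (ex i)).
  have hP i : forall f, F f -> f i <> h i by exact: (projT2 (cid (ex i))).
  apply: (Fmax (F `|` [set h])); last first.
    move=> f g i [Ff|->] [Fg|->] // fgi; first exact: PF fgi.
    - by case: (hP i _ Ff).
    - by case: (hP i _ Fg).
  split; first by move=> f; left.
  by move=> /(_ h (or_intror erefl)) /(hP d0); exact.
exists i => j.
have /choice[e eP] : forall x, exists f, F f /\ f i = x.
  by move=> x; have [f Ff fx] := Fi x; exists f.
apply/cardinal_leP; exists (fun x => e x j) => x y exy.
have [Fx <-] := eP x; have [Fy <-] := eP y.
by rewrite (PF _ _ j Fx Fy exy).
Qed.

Lemma cardinal_le_total (I J : Type) : cardinal_le I J \/ cardinal_le J I.
Proof.
have [[] ijP] := @cardinal_min bool (fun b =>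
  if b then I else J) (inhabits true).
  by left; exact: (ijP false).
by right; exact: (ijP true).
Qed.

(** * Arithmetic of cardinals below kappa *)

Section small_types.
Variable K : Type.
Hypothesis Kinf : infinite_set [set: K].
Hypothesis Kpow : is_weak_power K K.

Local Notation small L := (cardinal_lt L%type K).

Lemma small_le (I J : Type) : cardinal_le I J -> small J -> small I.
Proof.
move=> IJ [JK nKJ]; split; first exact: cardinal_le_trans JK.
by move=> KI; apply: nKJ; exact: cardinal_le_trans IJ.
Qed.

Lemma small_surj (I J : Type) (f : J -> I) :
  (forall i, exists j, f j = i) -> small J -> small I.
Proof. by move=> /surj_cardinal_le; exact: small_le. Qed.

Lemma small_finite (I : Type) : finite_set [set: I] -> small I.
Proof.
move=> Ifin; have nKI : ~ cardinal_le K I.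
  by move=> /card_le_finite /(_ Ifin); exact: Kinf.
by split=> //; have [] := cardinal_le_total I K.
Qed.

Lemma small_not_le (I : Type) : ~ cardinal_le K I -> small I.
Proof. by move=> nKI; split=> //; have [] := cardinal_le_total I K. Qed.

(** A pair is a function on [bool], and [bool] is below the infinite kappa, so this is an instance
    of kappa^{<kappa} = kappa. *)
Lemma prod_le : cardinal_le (K * K) K.
Proof.
have b : cardinal_le (bool -> K) K.
  by apply: Kpow.1; apply: small_finite; exact: finite_finset.
apply: cardinal_le_trans b; apply/cardinal_leP.
exists (fun x b => if b then x.1 else x.2) => -[a b] [c d] /= e.
by have := congr1 (@^~ true) e; have := congr1 (@^~ false) e => /= -> ->.
Qed.

(* Konig's diagonal argument. *)
Lemma small_sigma (I : Type) (F : I -> Type) :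
  small I -> (forall i, small (F i)) -> small {i & F i}.
Proof.
move=> sI sF; apply: small_not_le => KF.
have [k0 _] := infinite_setN0 Kinf.
(* There are at most kappa functions [I -> K], so under [KF] the sum type would map onto them; the
   [h] built next escapes every value of [f]. *)
have [f fP] := cardinal_le_surj (fun=> k0) (cardinal_le_trans (Kpow.1 _ sI) KF).
have /choice[h hP] : forall i, exists k, forall z : F i,
  f (existT F i z) i <> k.
  move=> i; apply: contrapT => nk; apply: (sF i).2.
  apply: (@surj_cardinal_le _ _ (fun z => f (existT F i z) i)) => k.
  apply: contrapT => nz; apply: nk; exists k => z zk; apply: nz; by exists z.
have [[i z] fz] := fP h.
by apply: (hP i z); rewrite fz.
Qed.

Lemma small_prod (I J : Type) : small I -> small J -> small (I * J).
Proof.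
move=> sI sJ; apply: (@small_surj _ {i : I & J} (fun z => (projT1 z,
  projT2 z))).
  by move=> [i j]; exists (existT _ i j).
exact: small_sigma.
Qed.

Lemma small_sum (I J : Type) : small I -> small J -> small (I + J).
Proof.
move=> sI sJ.
apply: (@small_surj _ {b : bool & if b then I else J}
   (fun z => match z with existT true i => inl i |
     existT false j => inr j end)).
  by move=> [i|j]; [exists (existT (fun b : bool => if b then I else J) true i)|
                  exists (existT (fun b : bool => if b then I else J) false j)].
apply: small_sigma; first by apply: small_finite; exact: finite_finset.
by case.
Qed.

(** For infinite [I] the type [nat] is small, and the tuples of all lengths form a small union of
    small sets. Finite [I] is treated apart because [nat] is not small when kappa is countable. *)
Lemma small_fset (I : choiceType) : small I -> small {fset I}.
Proof.
move=> sI; have [Ifin|Iinf] := pselect (finite_set [set: I]).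
  apply: small_finite.
  have /finite_fsetP[A AI] := Ifin.
  apply: (@sub_finite_set _ _ [set` fpowerset A]); last exact: finite_fset.
  move=> B _ /=; rewrite fpowersetE; apply/fsubsetP => x _.
  by have : [set: I] x by []; rewrite AI.
have sN : small nat by apply: small_le sI; apply/infiniteP.
have sseq n : small (n.-tuple I).
  elim: n => [|n IHn].
    by apply: small_finite;
      apply: (@sub_finite_set _ _ [set [tuple]]) => // x _;
      rewrite /= tuple0.
  apply: (@small_surj _ (I * n.-tuple I) (fun z => [tuple of z.1 :: z.2])).
    by move=> t; exists (thead t, [tuple of behead t]); rewrite /= -tuple_eta.
  exact: small_prod.
apply: (@small_surj _ {n : nat & n.-tuple I}
   (fun z => [fset x in tval (projT2 z)]%fset)).
  move=> B; exists (existT _ (size B) (in_tuple B)) => /=.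
  by apply/fsetP => x; rewrite inE.
exact: small_sigma.
Qed.

(* The order type of [lt] is the initial ordinal of [K]. *)
Lemma initial_order : exists (O : Type) (lt : O -> O -> Prop),
  [/\ well_founded lt, (forall a b c, lt a b -> lt b c -> lt a c),
      (forall a b, [\/ lt a b, a = b | lt b a]),
      (forall a, small {b | lt b a}) & cardinal_le K O].
Proof.
have [R woR] := well_ordering_principle {classic K}.
have Rmin (P : set K) : P !=set0 -> exists! a, P a /\ forall b, P b -> R a b.
  move=> [a Pa]; have [|m [[/asboolP Pm mP] um]] := woR (fun a => `[< P a >]).
    by exists a; exact/asboolP.
  exists m; split=> [|m' [Pm' m'P]].
    by split=> // b Pb; apply: mP; exact/asboolP.
  by apply: um; split=> [|b /asboolP]; [exact/asboolP|exact: m'P].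
have Rtot a b : R a b \/ R b a.
  have [|m [[[]-> mP] _]] := Rmin [set a; b]; first by exists a; left.
    by left; apply: mP; right.
  by right; apply: mP; left.
have Rxx a : R a a by have [] := Rtot a a.
have Ranti a b : R a b -> R b a -> a = b.
  move=> ab ba; have [|m [_ um]] := Rmin [set a; b]; first by exists a; left.
  by rewrite -(um a) ?(um b) //; split;
    [right|move=> c []->|left|move=> c []->].
pose lt (a b : K) := R a b /\ a <> b.
have lt_trans a b c : lt a b -> lt b c -> lt a c.
  move=> [ab nab] [bc nbc].
  have [|m [[[[]|] -> mP] _]] := Rmin [set a; b; c]; first by exists a;
    do 2!left.
  - split; first by apply: mP; right.
    by move=> ac; apply: nbc; apply: Ranti => //; rewrite -ac.
  - by case: nab; apply: Ranti => //; apply: mP; do 2!left.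
  - by case: nbc; apply: Ranti => //; apply: mP; left; right.
have lt_tri a b : [\/ lt a b, a = b | lt b a].
  have [->|ab] := pselect (a = b); first by constructor 2.
  have [abR|baR] := Rtot a b; first by constructor 1.
  by constructor 3; split=> // ba; exact: ab.
have lt_wf : well_founded lt.
  move=> a; apply: contrapT => na.
  have [|m [[nm mP] _]] := Rmin [set a | ~ Acc lt a]; first by exists a.
  apply: nm; constructor => b [bm nbm]; apply: contrapT => nb; apply: nbm.
  by apply: Ranti => //; exact: mP.
have [sseg|nsseg] := pselect (forall a, small {b | lt b a}).
  by exists K, lt; split=> //; exact: cardinal_le_refl.
(* Otherwise the order is cut at the least [m] whose segment has at least kappa elements; minimality
   keeps every segment below [m] small. *)
have [|m [[Km mP] _]] := Rmin [set a | cardinal_le K {b | lt b a}].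
  apply: contrapT => nm; apply: nsseg => a; apply: small_not_le => Ka.
  by apply: nm; exists a.
exists {b | lt b m}, (fun a b => lt (sval a) (sval b)); split; last exact: Km.
- exact: wf_inverse_image.
- by move=> a b c; exact: lt_trans.
- move=> a b; have [ab|/sval_inj ab|ba] := lt_tri (sval a) (sval b).
  + by constructor 1.
  + by constructor 2.
  + by constructor 3.
- move=> [a am]; apply: small_not_le => Ka.
  have [ma nam] := am; apply: nam; apply: Ranti => //; apply: mP.
  apply: cardinal_le_trans Ka _; apply/cardinal_leP.
  exists (fun c => exist (fun b => lt b a) (sval (sval c)) (svalP c)).
  by move=> b c [] /sval_inj /sval_inj.
Qed.

End small_types.

(** * Transfinite recursion along the initial ordinal of kappa *)

(** Recursion whose requirement [Q] on a value looks only at earlier values. The recursor chooses an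
    admissible value if there is one and [d0] otherwise; induction shows that the default never
    occurs. *)
Lemma wf_choice (O D : Type) (lt : O -> O -> Prop)
    (Q : O -> (O -> D) -> D -> Prop) :
  well_founded lt -> D ->
  (forall a f g d, (forall b, lt b a -> f b = g b) -> Q a f d -> Q a g d) ->
  (forall a f, (forall b, lt b a -> Q b f (f b)) -> exists d, Q a f d) ->
  exists f, forall a, Q a f (f a).
Proof.
move=> lt_wf d0 Qext Qstep.
pose ext a (r : forall b, lt b a -> D) b :=
  if pselect (lt b a) is left h then r b h else d0.
pose F a (r : forall b, lt b a -> D) :=
  if pselect (exists d, Q a (ext a r) d) is left e then projT1 (cid e) else d0.
pose f := Fix lt_wf (fun=> D) F.
have fE a : f a = F a (fun b _ => f b).
  rewrite /f Fix_eq // => {}a r r' rr'; congr F.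
  by apply: functional_extensionality_dep => b;
    apply: functional_extensionality_dep.
exists f; apply: (well_founded_ind lt_wf) => a IH.
have [d Qd] := Qstep a f IH.
have extE b : lt b a -> f b = ext a (fun b _ => f b) b.
  by rewrite /ext; case: pselect.
rewrite fE /F; case: pselect => [e|[]]; last by exists d; apply: Qext Qd.
by apply: Qext (projT2 (cid e)) => b /extE.
Qed.

Section initial_order_theory.
Variables (K O : Type) (lt : O -> O -> Prop).
Hypothesis Kinf : infinite_set [set: K].
Hypothesis Kpow : is_weak_power K K.
Hypothesis lt_wf : well_founded lt.
Hypothesis lt_trans : forall a b c, lt a b -> lt b c -> lt a c.
Hypothesis lt_tri : forall a b, [\/ lt a b, a = b | lt b a].
Hypothesis lt_seg : forall a, cardinal_lt {b | lt b a} K.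
Hypothesis KO : cardinal_le K O.

(** Regularity of kappa: the members of an unbounded small family, together with their segments,
    would cover [O] by a small union of small sets. *)
Lemma small_bounded (I : Type) (a : I -> O) : cardinal_lt I K ->
  exists b, forall i, lt (a i) b.
Proof.
move=> sI; apply: contrapT => nb.
have : cardinal_lt ({i : I & {b | lt b (a i)}} + I)%type K.
  by apply: small_sum => //; exact: small_sigma.
move=> [_]; apply; apply: cardinal_le_trans KO _.
apply: (@surj_cardinal_le _ _
  (fun z => match z with inl s => sval (projT2 s) | inr i => a i end)) => b.
apply: contrapT => nz; apply: nb; exists b => i.
have [//|ab|ba] := lt_tri (a i) b; first by case: nz; exists (inr i).
by case: nz; exists (inl (existT _ i (exist _ b ba))).
Qed.

Lemma fset_max (s : {fset {classic O}}) : s != fset0 ->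
  exists2 m, m \in s & forall x, x \in s -> x = m \/ lt x m.
Proof.
move=> /fset0Pn[x0 x0s].
suff /(_ (enum_fset s) x0 x0s) : forall (r : seq {classic O}) x, x \in r ->
  exists2 m, m \in r & forall x, x \in r -> x = m \/ lt x m by [].
elim=> // x [|y r] IHr _ _.
  by exists x => [|z]; rewrite inE // => /eqP; left.
have [|m mr mP] := IHr y; first exact: mem_head.
have [xm|xm|mx] := lt_tri x m.
- exists m => [|z]; first by rewrite inE mr orbT.
  by rewrite inE => /orP[/eqP->|/mP]; [right|].
- exists m => [|z]; first by rewrite inE mr orbT.
  by rewrite inE => /orP[/eqP->|/mP]; [left|].
- exists x => [|z]; first exact: mem_head.
  rewrite inE => /orP[/eqP->|/mP[->|zm]]; [by left|by right|right].
  exact: lt_trans mx.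
Qed.

End initial_order_theory.

(** * Compact zero-dimensional spaces *)

Section compact_base.
Variable S : topologicalType.
Hypothesis Scompact : compact [set: S].

Lemma compact_fip (I : Type) (D : set S) (a : I -> set S) :
  closed D -> (forall i, closed (a i)) ->
  (forall s : {fset {classic I}},
    exists2 x, D x & forall i, i \in s -> a i x) ->
  exists2 x, D x & forall i, a i x.
Proof.
move=> cD ca fip; have [x0 _ _] := fip fset0.
(* The witness [x0] for the empty subfamily makes the space pointed. Below, [D] joins the family as
   the extra index [None]. *)
pose S' : ptopologicalType :=
  HB.pack (S : Type) (isPointed.Build S x0) (Topological.on S).
have : compact [set: S'] by [].
rewrite compact_In0 => /(_ (option {classic I}) setT
  (fun i => if i is Some i then a i else D)) [].
- exists (fun i => if i is Some i then a i else D); last by move=> ? _;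
    rewrite setTI.
  by move=> [i|] _; [exact: ca|exact: cD].
- move=> A _; pose s : {fset {classic I}} := [fset i | i in pmap id A]%fset.
  have [x Dx sx] := fip s; exists x => -[i|] //= iA.
  by apply: sx; rewrite inE /= mem_pmap; apply/mapP; exists (Some i).
- by move=> x xP; exists x; [exact: (xP None)|move=> i; exact: (xP (Some i))].
Qed.

Lemma clopen_setD (c d : set S) : clopen c -> clopen d -> clopen (c `\` d).
Proof. by move=> cc cd; rewrite setDE; apply: clopenI => //;
  exact: clopenC. Qed.

Lemma clopen_fin (I : choiceType) (s : {fset I}) (a : I -> set S) :
  (forall i, clopen (a i)) -> clopen [set x | forall i, i \in s -> a i x].
Proof.
move=> ca.
have -> : [set x | forall i, i \in s -> a i x] =
  \bigcap_(i in [set` s]) a i by [].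
rewrite bigcap_fset; elim/big_ind: _ => //; [exact: clopenT|exact: clopenI].
Qed.

Hypothesis Sbase : has_clopen_base S.

Lemma clopen_nbhs (x : S) (U : set S) : nbhs x U ->
  exists c, [/\ clopen c, c x & c `<=` U].
Proof.
have [B [oB bB] Bc] := Sbase => /bB[c [Bc' cx] cU]; exists c; split=> //.
exact: Bc.
Qed.

Lemma clopen_open (x : S) (U : set S) : open U -> U x ->
  exists c, [/\ clopen c, c x & c `<=` U].
Proof. by move=> oU Ux; apply: clopen_nbhs; apply: open_nbhs_nbhs. Qed.

End compact_base.

Lemma infinite_neq (K : Type) (k0 : K) : infinite_set [set: K] ->
  exists k, k <> k0.
Proof.
move=> Kinf; apply: contrapT => nk; apply: Kinf.
apply: (@sub_finite_set _ _ [set k0]) => // k _.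
by apply: contrapT => kk0; apply: nk; exists k.
Qed.

(** Lists are coded through an injection of [K * K] into [K], two distinct tags [k0] and [k1]
    telling the empty list from the others. *)
Lemma seq_le (K : Type) : infinite_set [set: K] -> is_weak_power K K ->
  cardinal_le (seq K) K.
Proof.
move=> Kinf Kpow; have /cardinal_leP[e einj] := prod_le Kinf Kpow.
have [k0 _] := infinite_setN0 Kinf; have [k1 k10] := infinite_neq k0 Kinf.
pose f := fix f s := if s is x :: s then e (k1, e (x, f s)) else e (k0, k0).
apply/cardinal_leP; exists f; elim=> [|x s IHs] [|y r] //= /einj [].
- by move=> /esym.
- by [].
- by move=> /einj [-> /IHs ->].
Qed.

Section compact_zero_dimensional.
Variable S : topologicalType.
Hypothesis Scompact : compact [set: S].

Lemma closed_finite_cover (C : set S) (I : Type) (a : I -> set S) :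
  closed C -> (forall i, open (a i)) -> C `<=` \bigcup_i a i ->
  exists s : {fset {classic I}}, forall x, C x -> exists2 i, i \in s & a i x.
Proof.
move=> cC oa Ca; apply: contrapT => ns.
have [|s|x Cx xa] := compact_fip Scompact cC (a := fun i => ~` a i).
- by move=> i; exact: open_closedC.
- apply: contrapT => nx; apply: ns; exists s => x Cx.
  apply: contrapT => ni; apply: nx; exists x => // i si ai.
  by apply: ni; exists i.
- by have [i _] := Ca x Cx; exact: xa.
Qed.

Hypothesis Sbase : has_clopen_base S.

Lemma clopen_between (C W : set S) : closed C -> open W -> C `<=` W ->
  exists c, [/\ clopen c, C `<=` c & c `<=` W].
Proof.
move=> cC oW CW.
have [||s sP] := @closed_finite_cover C {c |
  clopen c /\ c `<=` W} (fun c => sval c) cC.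
- by move=> c; exact: (svalP c).1.1.
- move=> x /CW Wx; have [c [cc cx cW]] := clopen_open Sbase oW Wx.
  by exists (exist _ c (conj cc cW)).
(* This is the union of the finite subcover, written by De Morgan so that [clopen_fin] applies. *)
exists (~` [set x | forall c, c \in s -> (~` sval c) x]); split.
- apply: clopenC; first exact: set0.
  apply: (@clopen_fin _ {classic {c | clopen c /\ c `<=` W}}) => c.
  by apply: clopenC; [exact: set0|exact: (svalP c).1].
- by move=> x /sP[c cs cx] /(_ _ cs).
- move=> x /existsNP[c /not_implyP[cs /contrapT cx]].
  exact: (svalP c).2.
Qed.

Hypothesis Shaus : hausdorff_space S.

Lemma closed_point (x : S) : closed [set x].
Proof. exact/accessible_closed_set1/hausdorff_accessible. Qed.

Lemma clopen_separated (x : S) (C : set S) : closed C -> ~ C x ->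
  exists c, [/\ clopen c, c x & forall y, C y -> ~ c y].
Proof.
move=> cC nCx; have [|c [cc cx cC']] :=
  clopen_open Sbase (closed_openC cC) (x := x).
  by [].
by exists c; split=> // y Cy /cC'.
Qed.

End compact_zero_dimensional.

(** * The type of an open set *)

Section clopen_union_types.
Variables (S : topologicalType) (U : set S).

Lemma clopen_union_of_surj (I J : Type) (g : J -> I) :
  (forall i, exists j, g j = i) -> clopen_union_of U I -> clopen_union_of U J.
Proof.
move=> gs [F cF UF]; exists (F \o g) => [j|]; first exact: cF.
rewrite UF; apply/seteqP; split=> [x [i _ Fx]|x [j _ Fx]]; last by exists (g j).
by have [j gj] := gs i; exists j => //=; rewrite gj.
Qed.

(** A least cardinal is sought among the subsets of [L] only, so that the candidates are indexed by
    one type and [cardinal_min] applies; any smaller index type embeds as such a subset. *)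
Lemma is_open_type_ex (L : Type) : clopen_union_of U L ->
  exists2 T, is_open_type U T & cardinal_le T L.
Proof.
move=> UL; pose D := {P : L -> Prop | clopen_union_of U {x | P x}}.
have D0 : inhabited D.
  constructor; exists (fun=> True).
  apply: (@clopen_union_of_surj _ _ (fun x => sval x) _ UL) => i.
  by exists (exist _ i Logic.I).
have [[P UP] Pmin] := @cardinal_min D (fun P => {x | sval P x}) D0.
exists {x | P x}; last first.
  by apply/cardinal_leP; exists sval; exact: sval_inj.
split=> // I UI; have [//|/cardinal_leP[f fi]] := cardinal_le_total {x | P x} I.
pose P' x := exists i, sval (f i) = x.
have UP' : clopen_union_of U {x | P' x}.
  have /choice[g gP] : forall z : {x | P' x}, exists i, sval (f i) = sval z.
    by move=> z; have [i ix] := svalP z; exists i.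
  apply: (@clopen_union_of_surj _ _ g _ UI) => i.
  exists (exist P' _ (ex_intro _ i erefl)); apply: fi; apply: sval_inj.
  exact: gP.
apply: cardinal_le_trans (Pmin (exist _ P' UP')) _ => /=.
apply: (@surj_cardinal_le _ _ (fun i => exist P' _ (ex_intro _ i erefl))).
by move=> [x [i ix]]; exists i; exact: sval_inj.
Qed.

End clopen_union_types.

(** * Combinatorial properties of Parovicenko spaces *)

Definition clopen_enumerated (K : Type) (S : topologicalType) : Prop :=
  exists v : K -> set S, forall c, clopen c -> exists k, v k = c.

(** The form in which C*-embedding of open sets of small type enters the back-and-forth. *)
Definition clopen_separation (K : Type) (S : topologicalType) : Prop :=
  forall (I J : Type) (a : I -> set S) (b : J -> set S),
    cardinal_lt I K -> cardinal_lt J K ->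
    (forall i, clopen (a i)) -> (forall j, clopen (b j)) ->
    (forall i j x, a i x -> ~ b j x) ->
  exists c, [/\ clopen c, forall i, a i `<=` c & forall j x, b j x -> ~ c x].

(** This merges the interior property of small intersections with the absence of isolated points. *)
Definition clopen_splitting (K : Type) (S : topologicalType) : Prop :=
  forall (I : Type) (a : I -> set S) (x : S), cardinal_lt I K ->
    (forall i, clopen (a i)) -> (forall i, a i x) ->
  exists c d : set S, [/\ clopen c /\ clopen d, c !=set0 /\ d !=set0,
    forall i, c `<=` a i, forall i, d `<=` a i & forall x, c x -> ~ d x].

Section Parovicenko_theory.
Variables (R : realType) (K : Type).
Hypothesis Kinf : infinite_set [set: K].
Hypothesis Kpow : is_weak_power K K.
Variable S : topologicalType.
Hypothesis hS : Parovicenko R K S.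

Lemma Parovicenko_compact : compact [set: S].
Proof. by have [[]] := hS. Qed.

Lemma Parovicenko_hausdorff : hausdorff_space S.
Proof. by have [[]] := hS. Qed.

Lemma Parovicenko_clopen_base : has_clopen_base S.
Proof. by have [_ []] := hS. Qed.

Let Scompact := Parovicenko_compact.
Let Shaus := Parovicenko_hausdorff.
Let Sbase := Parovicenko_clopen_base.

(** An empty space has only finite bases, while the weight kappa^{<kappa} is infinite. *)
Lemma Parovicenko_nonempty : inhabited S.
Proof.
apply: contrapT => nS; have [_ _ [W Wpow [[B bB BW] _]] _ _] := hS.
apply: Kinf.
have KW : cardinal_le (unit -> K) W.
  by apply: Wpow.1; apply: small_finite => //; exact: finite_finset.
have : finite_set [set: set S].
  apply: (@sub_finite_set _ _ [set set0]) => // A _ /=.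
  by apply/seteqP; split=> // x; case: nS; constructor.
move=> /(@sub_finite_set _ B setT (fun _ _ => Logic.I)) Bfin.
have Wfin : finite_set [set: W] by rewrite -(eq_finite_set BW).
have : cardinal_le K (unit -> K).
  by apply: (@surj_cardinal_le _ _ (fun f => f tt)) => k; exists (fun=> k).
by move=> /cardinal_le_trans /(_ KW) /card_le_finite; apply.
Qed.

Lemma nonisolated (x : S) (U : set S) : nbhs x U -> exists2 y, U y & y <> x.
Proof.
move=> Ux; apply: contrapT => ny; have [_ _ _ noiso _] := hS.
suff : isolated [set: S] x by rewrite noiso.
split; first exact: mem_setT.
exists U => //; rewrite setIT; apply/seteqP; split=> [y Uy|_ ->].
  by apply: contrapT => yx; apply: ny; exists y.
exact: nbhs_singleton.
Qed.

(** By compactness a clopen set is a finite union from a base of size at most kappa, and finite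
    lists over [K] are coded by [K]. *)
Lemma Parovicenko_enumerated : clopen_enumerated K S.
Proof.
have [_ _ [W Wpow [[B [oB bB] BW] _]] _ _] := hS.
have BK : B #<= [set: K].
  apply: (card_le_trans _ (Wpow.2 _ Kpow.1)); by have /card_eqPle[] := BW.
have [w wP] := pcard_surjP BK.
have [k0 _] := infinite_setN0 Kinf.
have [dec decP] := cardinal_le_surj (@nil K) (seq_le Kinf Kpow).
exists (fun k => \bigcup_(i in [set i | i \in (dec k : seq {classic K})]) w i).
move=> c [oc cc].
(* The map [w] is only known to reach every member of [B], hence the clause that [w k] is open. *)
pose I := {k | w k `<=` c /\ open (w k)}.
have [||s sP] := closed_finite_cover Scompact (a := fun k : I => w (sval k)) cc.
- by move=> k; exact: (svalP k).2.
- move=> x cx; have [b [Bb bx] bc] := bB x c (open_nbhs_nbhs (conj oc cx)).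
  have [k _ wk] := wP _ Bb.
  have kI : w k `<=` c /\ open (w k) by rewrite wk; split=> //; exact: oB.
  by exists (exist _ k kI) => //=; rewrite wk.
have [k kP] := decP (@map {classic I} {classic K} sval (enum_fset s)); exists k.
rewrite kP; apply/seteqP; split=> [x [i /= /mapP[j _ ->]]|x cx].
  exact: (svalP j).1.
have [i si wi] := sP _ cx; exists (sval i) => //=.
by apply/mapP; exists i.
Qed.

(** The indicator of [A] is continuous and bounded on the union of [A] and [B]. It extends to some
    [g], and a clopen set between [1 <= g] and [0 < g] separates. *)
Lemma Parovicenko_separation : clopen_separation K S.
Proof.
move=> I J a b sI sJ ca cb ab.
pose A := \bigcup_i a i; pose B := \bigcup_j b j; pose U := A `|` B.
have oA : open A by apply: bigcup_open => i _; exact: (ca i).1.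
have oB : open B by apply: bigcup_open => i _; exact: (cb i).1.
have AB x : A x -> B x -> False by move=> [i _ ai] [j _]; exact: (ab i j x).
have UIJ : clopen_union_of U (I + J).
  exists (fun k => match k with inl i => a i | inr j => b j end); first by case.
  apply/seteqP; split=> [x [[i _ ix]|[j _ jx]]|x [[i|j] _ ix]].
  - by exists (inl i).
  - by exists (inr j).
  - by left; exists i.
  - by right; exists j.
have [T TU TIJ] := is_open_type_ex UIJ.
have [_ [_ Sext] _ _ _] := hS.
have UE : Cstar_embedded R U.
  apply: Sext; first exact: openU.
  by exists T => //; apply: small_le TIJ _; exact: small_sum.
pose f (y : set_type U) : R := if `[< A (val y) >] then 1%R else 0%R.
have [||g gcont gf] := UE f.
- have cval : continuous (set_val : U -> S) by exact: initial_continuous.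
  move=> y W /= /nbhs_singleton Wfy; rewrite nbhs_simpl.
  have [Ay|By] : U (val y) by exact: set_valP.
    have : nbhs y (set_val @^-1` A) by apply: cval; apply: open_nbhs_nbhs.
    apply: filterS => z Az; change (W (f z)); suff -> : f z = f y by [].
    by rewrite /f !asboolT.
  have : nbhs y (set_val @^-1` B) by apply: cval; apply: open_nbhs_nbhs.
  apply: filterS => z Bz; change (W (f z)); suff -> : f z = f y by [].
  by rewrite /f !asboolF // => Az; apply: AB; eassumption.
- exists 1%R => y; rewrite /f; case: ifP; rewrite ?normr1 ?normr0 ?lexx //.
have [|||c [cc c1 c2]] := @clopen_between S Scompact Sbase
    (g @^-1` [set r | (1 <= r)%R]) (g @^-1` [set r | (0 < r)%R]).
- by apply: preimage_closed => //; exact: closed_ge.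
- by apply: open_comp => //; exact: open_gt.
- by move=> x /=; exact: lt_le_trans.
exists c; split=> // [i x ai|j x bj cx].
  apply: c1 => /=; have Ux : x \in U by apply: mem_set; left; exists i.
  rewrite (gf (exist _ x Ux)) /f asboolT //=; by exists i.
have /= := c2 _ cx; have Ux : x \in U by apply: mem_set; right; exists j.
rewrite (gf (exist _ x Ux)) /f asboolF ?ltxx //= => Ax.
by apply: (AB x) => //; exists j.
Qed.

(** The intersection has an interior point [y]. A clopen neighbourhood of [y] inside it contains a
    second point [z], and is cut in two between [y] and [z]. *)
Lemma Parovicenko_splitting : clopen_splitting K S.
Proof.
move=> I a x sI ca ax; have [_ _ _ _ Sint] := hS.
have [|y yint] := Sint I a sI (fun i => (ca i).1); first by exists x.
have [c [cc cy cint]] := clopen_nbhs Sbase yint.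
have [z cz zy] := nonisolated (open_nbhs_nbhs (conj cc.1 cy)).
have [e [ce ez ye]] := clopen_separated Sbase (closed_point Shaus (x := y)) zy.
exists (c `&` e), (c `\` e); split.
- by split; [exact: clopenI|exact: clopen_setD].
- by split; [exists z|exists y; split=> //; exact: ye].
- by move=> i t [/cint ct _]; exact: ct.
- by move=> i t [/cint ct _]; exact: ct.
- by move=> t [_ et] [_].
Qed.

End Parovicenko_theory.

(** * P-sets and one step of the back-and-forth *)

(** Non-openness guarantees that every clopen superset of [T] has points outside [T], so that a cell
    containing [T] can still be split away from [T]. *)
Definition P_set (K : Type) (S : topologicalType) (T : set S) : Prop :=
  [/\ closed T, T !=set0, ~ open T &
      forall (I : Type) (c : I -> set S), cardinal_lt I K ->
        (forall i, clopen (c i)) -> (forall i, T `<=` c i) ->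
      exists e, [/\ clopen e, T `<=` e & forall i, e `<=` c i]].

Section back_and_forth.
Variables (K : Type) (S : topologicalType).
Hypothesis Kinf : infinite_set [set: K].
Hypothesis Kpow : is_weak_power K K.
Hypothesis Scompact : compact [set: S].
Hypothesis Shaus : hausdorff_space S.
Hypothesis Sbase : has_clopen_base S.
Hypothesis Ssep : clopen_separation K S.
Hypothesis Ssplit : clopen_splitting K S.

Lemma clopen_agree (d : set S) (P : Prop) : clopen d ->
  clopen [set y | d y <-> P].
Proof.
move=> cd; have [p|np] := pselect P.
  by have -> : [set y | d y <-> P] = d by apply/seteqP; split=> y /=; tauto.
have -> : [set y | d y <-> P] = ~` d by apply/seteqP; split=> y /=; tauto.
by apply: clopenC => //; exact: set0.
Qed.

(** If some [d l] contains [y], the cell of [y] misses [T] and splitting applies at once. Otherwise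
    the cell contains [T]: the P-set property gives a clopen [u] between them, and the splitting
    takes place in [u] near a point [w] outside [T]. *)
Lemma cell_split (T : set S) (L : Type) (d : L -> set S) (y : S) :
  P_set K T -> cardinal_lt L K -> (forall l, clopen (d l)) ->
  (forall l x, T x -> ~ d l x) ->
  exists a b : set S, [/\ clopen a /\ clopen b, a !=set0 /\ b !=set0,
    forall z, T z -> ~ a z /\ ~ b z,
    forall z, a z \/ b z -> forall l, d l z <-> d l y & forall z, a z -> ~ b z].
Proof.
move=> [Tcl T0 Tnop TP] sL cd dT.
pose e l := [set z | d l z <-> d l y].
have ce l : clopen (e l) by exact: clopen_agree.
have [[l ly]|nly] := pselect (exists l, d l y).
  have [a [b [cab nab ae be ab]]] := Ssplit sL ce (fun l => iff_refl (d l y)).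
  exists a, b; split=> // [z Tz|z [az|bz] k]; [|exact: ae|exact: be].
  by split=> [/ae|/be] /(_ l) /= zl; apply: (dT l z Tz); exact/zl.
have [|u [cu Tu ue]] := TP _ e sL ce.
  by move=> l z Tz; split=> [/(dT l z Tz)|ly] //; case: nly; exists l.
have [w uw Tw] : exists2 w, u w & ~ T w.
  apply: contrapT => nw; apply: Tnop; suff -> : T = u by exact: cu.1.
  apply/seteqP; split=> // w uw; apply: contrapT => Tw; apply: nw; by exists w.
have [v [cv vw Tv]] := clopen_separated Sbase Tcl Tw.
have [] := @Ssplit unit (fun=> u `&` v) w.
- by apply: small_finite => //; exact: finite_finset.
- by move=> _; exact: clopenI.
- by [].
move=> a [b [cab nab /(_ tt) auv /(_ tt) buv ab]]; exists a, b; split=> //.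
- by move=> z Tz; split=> [/auv|/buv] [_]; exact: Tv.
- by move=> z [/auv|/buv] [uz _] l; exact: ue uz.
Qed.

Section one_step.
Variables (T T' : set S) (L : Type) (c d : L -> set S).
Hypothesis PT : P_set K T.
Hypothesis PT' : P_set K T'.
Hypothesis sL : cardinal_lt L K.
Hypothesis cc : forall l, clopen (c l).
Hypothesis cd : forall l, clopen (d l).
Hypothesis cT : forall l x, T x -> ~ c l x.
Hypothesis dT : forall l x, T' x -> ~ d l x.
Hypothesis forth : forall x, exists y, forall l, c l x <-> d l y.
Hypothesis back : forall y, exists x, forall l, c l x <-> d l y.

(** A finite membership pattern: the indices inspected, and those whose sets are to contain the
    point. There are fewer than kappa patterns, whereas there may be too many cells. *)
Let M := ({fset {classic L}} * {fset {classic L}})%type.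

Let cyl (f : L -> set S) (m : M) : set S :=
  [set x | forall l, l \in m.1 -> (f l x <-> l \in m.2)].

Let code (f : L -> set S) (s : {fset {classic L}}) (x : S) : M :=
  (s, [fset l in s | `[< f (l : L) x >]]%fset).

Let sM : cardinal_lt M K.
Proof. by apply: small_prod => //; exact: small_fset. Qed.

Let cyl_clopen f m : (forall l, clopen (f l)) -> clopen (cyl f m).
Proof.
move=> cf; apply: (@clopen_fin _ {classic L} m.1 (fun l => [set x |
  f l x <-> l \in m.2])).
by move=> l; exact: clopen_agree.
Qed.

Let cyl_match f g m x y : (forall l, f l x <-> g l y) ->
  cyl f m x <-> cyl g m y.
Proof.
by move=> xy; split=> h l lm; have := h l lm; have := xy l; tauto.
Qed.

Let codeP f s x z : cyl f (code f s x) z <-> forall l, l \in s ->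
  (f l z <-> f l x).
Proof.
have e l : l \in s -> is_true (l \in (code f s x).2) = f l x.
  by move=> ls; rewrite !inE ls /= asboolE.
by split=> h l ls; have := h l ls; rewrite /= e.
Qed.

(** Patterns whose [c]-cylinder lies inside or outside [c'] force the same of [d'] on the
    [d]-cylinder. Where nothing is forced, [d'] has to meet and to miss enough cells; half cells of
    fewer than kappa sample points suffice by compactness. *)
Lemma one_step (c' : set S) : clopen c' -> (forall x, T x -> ~ c' x) ->
  exists d', [/\ clopen d', forall x, T' x -> ~ d' x,
    forall x, exists y, (forall l, c l x <-> d l y) /\ (c' x <-> d' y) &
    forall y, exists x, (forall l, c l x <-> d l y) /\ (c' x <-> d' y)].
Proof.
move=> cc' c'T.
pose undec y := forall m, cyl d m y ->
  ~ (cyl c m `<=` c') /\ ~ (cyl c m `<=` ~` c').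
(* One undecided sample point is chosen for each pattern that has any. *)
have /choice[w wP] : forall m, exists w : option S,
    if w is Some y then undec y /\ cyl d m y
    else forall y, undec y -> ~ cyl d m y.
  move=> m; have [[y yP]|ny] := pselect (exists y, undec y /\ cyl d m y).
    by exists (Some y).
  by exists None => y uy my; apply: ny; exists y.
(* The halves depend only on the membership function of [y], so that two sample points in one cell
   receive the same halves. *)
have [q qP] : exists q : (L -> Prop) -> set S * set S, forall y,
    let a := (q (d^~ y)).1 in let b := (q (d^~ y)).2 in
    [/\ clopen a /\ clopen b, a !=set0 /\ b !=set0,
     forall z, T' z -> ~ a z /\ ~ b z,
     forall z, a z \/ b z -> forall l, d l z <-> d l y &
     forall z, a z -> ~ b z].
  have /choice[q qP] : forall t : L -> Prop, exists p : set S * set S, forall y,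
      t = d^~ y ->
    [/\ clopen p.1 /\ clopen p.2, p.1 !=set0 /\ p.2 !=set0,
     forall z, T' z -> ~ p.1 z /\ ~ p.2 z,
     forall z, p.1 z \/ p.2 z -> forall l, d l z <-> d l y &
     forall z, p.1 z -> ~ p.2 z].
    move=> t; have [[y ->]|ny] := pselect (exists y, t = d^~ y).
      have [a [b [? ? ? ab ?]]] := cell_split y PT' sL cd dT.
      exists (a, b) => y' yy'; split=> // z zab l.
      have -> : d l y' = d l y by exact: (esym (congr1 (@^~ l) yy')).
      exact: ab.
    by exists (set0, set0) => y ty; case: ny; exists y.
  by exists q => y; exact: qP.
pose pc y := (q (d^~ y)).1; pose pd y := (q (d^~ y)).2.
have pcd y z z' : pc y z -> pd z' z -> False.
  move=> yz z'z; have [_ _ _ yP ydis] := qP y; have [_ _ _ z'P _] := qP z'.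
  suff e : d^~ y = d^~ z' by apply: (ydis z yz); rewrite e.
  apply/funext => l; apply/propext.
  by rewrite -(yP z (or_introl yz) l) -(z'P z (or_intror z'z) l).
(* The sets [a k] have to lie inside [d'] and the sets [b k] outside; [inl] carries what is forced,
   [inr] the half cells. *)
pose a (k : M + M) : set S := match k with
  | inl m => [set z | cyl c m `<=` c' /\ cyl d m z]
  | inr m => if w m is Some y then pc y else set0 end.
pose b (k : M + M) : set S := match k with
  | inl m => [set z | cyl c m `<=` ~` c' /\ cyl d m z]
  | inr m => if w m is Some y then pd y else set0 end.
have clopen_and (P : Prop) (e : set S) : clopen e -> clopen [set z | P /\ e z].
  move=> ce; have [p|np] := pselect P.
    by have -> : [set z | P /\ e z] = e by apply/seteqP; split=> z //= -[].
  have -> : [set z | P /\ e z] = set0 by apply/seteqP; split=> z //= -[].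
  exact: clopen0.
have ca k : clopen (a k).
  case: k => m /=; first by apply: clopen_and; exact: cyl_clopen.
  by case: (w m) => [y|]; [case: (qP y) => -[]|exact: clopen0].
have cb k : clopen (b k).
  case: k => m /=; first by apply: clopen_and; exact: cyl_clopen.
  by case: (w m) => [y|]; [case: (qP y) => -[]|exact: clopen0].
have aT k z : T' z -> ~ a k z.
  move=> T'z; case: k => m /=.
    (* All [c l] miss [T] and all [d l] miss [T'], so points of [T] and of [T'] satisfy the same
       patterns; but [c'] misses [T]. *)
    move=> [mc' mz]; have [_ [x0 Tx0] _ _] := PT.
    have x0z l : c l x0 <-> d l z by split=> [/(cT Tx0)|/(dT T'z)].
    by apply: (c'T x0 Tx0); apply: mc'; exact/(cyl_match m x0z).
  by case: (w m) => [y|//]; case: (qP y) => _ _ /(_ z T'z)[].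
have ab k k' z : a k z -> ~ b k' z.
  case: k k' => m [] m' /=.
  - move=> [mc' mz] [m'c' m'z]; have [x xz] := back z.
    apply: (m'c' x); first exact/(cyl_match _ xz).
    by apply: mc'; exact/(cyl_match _ xz).
  - move=> [mc' mz]; have := wP m'; case: (w m') => [y [uy _] yz|_ []].
    have [_ _ _ /(_ z (or_intror yz)) yP _] := qP y.
    by have [] := uy m ((cyl_match m yP).1 mz).
  - have := wP m; case: (w m) => [y [uy _] yz [mc' mz]|_ []].
    have [_ _ _ /(_ z (or_introl yz)) yP _] := qP y.
    by have [] := uy m' ((cyl_match m' yP).1 mz).
  - by case: (w m) => [y|[]] yz; case: (w m') => [y'|[]]; exact: pcd yz.
have sMM : cardinal_lt (M + M)%type K by exact: small_sum.
have [d0 [cd0 ad0 bd0]] := Ssep sMM sMM ca cb ab.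
(* The separating set [d0] may meet [T']; a clopen superset [e] of [T'] disjoint from every [a k]
   can be removed from it. *)
have [e [ce T'e ea]] : exists e, [/\ clopen e, T' `<=` e &
    forall k, e `<=` ~` a k].
  have [_ _ _ TP] := PT'; apply: TP sMM _ _.
    by move=> k; apply: clopenC => //; exact: set0.
  by move=> k z T'z; exact: aT.
pose d' := d0 `\` e.
have ad' k : a k `<=` d' by move=> z kz; split; [exact: ad0 kz|move=> ez;
  exact: (ea k z ez kz)].
have bd' k z : b k z -> ~ d' z by move=> kz [d0z _]; exact: bd0 kz d0z.
have cd' : clopen d' by exact: clopen_setD.
have undecided y s : undec y ->
  exists2 y', undec y' & w (code d s y) = Some y' /\
    cyl d (code d s y) y'.
  move=> uy; have := wP (code d s y); case: (w _) => [y' [uy' y'P]|];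
    first by exists y'.
  by move=> /(_ y uy) []; apply/codeP.
exists d'; split=> //.
- by move=> x T'x [_]; apply; exact: T'e.
- move=> x; have [y0 xy0] := forth x; have [c'x|c'x] := pselect (c' x).
    have [[m [my0 mc']]|nm] := pselect (exists m,
      cyl d m y0 /\ cyl c m `<=` c').
      by exists y0; split=> //; split=> // _; apply: (ad' (inl m)).
    have uy0 : undec y0.
      move=> m my0; split=> mc'; first by apply: nm; exists m.
      by apply: mc' c'x; exact/(cyl_match _ xy0).
    (* Each finite pattern of [y0] has a sample point [y1], whose first half cell lies in [d'];
       compactness then realizes the whole cell of [y0] inside [d']. *)
    have [|||y d'y yP] := compact_fip Scompact (D := d')
      (a := fun l => [set y | d l y <-> d l y0]).
    + exact: cd'.2.
    + by move=> l; exact: (clopen_agree _ (cd l)).2.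
    + move=> s; have [y1 uy1 [oy1 my1]] := undecided y0 s uy0.
      have [_ [[z yz] _] _ y1z _] := qP y1.
      exists z; first by apply: (ad' (inr (code d s y0))); rewrite /= oy1.
      by apply/codeP; apply/(cyl_match _ (y1z z (or_introl yz))).
    by exists y; split=> // l; have := xy0 l; have := yP l; rewrite /=; tauto.
  have [[m [my0 mc']]|nm] := pselect (exists m,
    cyl d m y0 /\ cyl c m `<=` ~` c').
    by exists y0; split=> //; split=> // d'y0; case: (bd' (inl m) y0).
  have uy0 : undec y0.
    move=> m my0; split=> mc'; last by apply: nm; exists m.
    by apply: c'x; apply: mc'; exact/(cyl_match _ xy0).
  have [|||y d'y yP] := compact_fip Scompact (D := ~` d')
    (a := fun l => [set y | d l y <-> d l y0]).
  + exact: open_closedC cd'.1.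
  + by move=> l; exact: (clopen_agree _ (cd l)).2.
  + move=> s; have [y1 uy1 [oy1 my1]] := undecided y0 s uy0.
    have [_ [_ [z yz]] _ y1z _] := qP y1.
    exists z; first by apply: (bd' (inr (code d s y0))); rewrite /= oy1.
    by apply/codeP; apply/(cyl_match _ (y1z z (or_intror yz))).
  by exists y; split=> // l; have := xy0 l; have := yP l; rewrite /=; tauto.
- move=> y; have [x0 x0y] := back y.
  have [[m [my mc']]|nm] := pselect (exists m, cyl d m y /\ cyl c m `<=` c').
    exists x0; split=> //; split=> _; first by apply: (ad' (inl m)).
    by apply: mc'; exact/(cyl_match _ x0y).
  have [[m [my mc']]|nm'] := pselect (exists m,
    cyl d m y /\ cyl c m `<=` ~` c').
    exists x0; split=> //; split=> [c'x0|d'y]; last by case: (bd' (inl m) y).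
    by case: (mc' x0) => //; exact/(cyl_match _ x0y).
  (* If no pattern of [y] excludes [D], compactness finds a point of [D] in the cell of [x0]. This
     is used for [c'] and for its complement. *)
  have fip (D : set S) : closed D -> (forall m, cyl d m y ->
    ~ (cyl c m `<=` ~` D)) ->
      exists2 x, D x & forall l, c l x <-> d l y.
    move=> cD Dm; have [|||x Dx xP] :=
      compact_fip Scompact (D := D) (a := fun l => [set x | c l x <-> c l x0]).
    + by [].
    + by move=> l; exact: (clopen_agree _ (cc l)).2.
    + move=> s; have : ~ (cyl c (code c s x0) `<=` ~` D).
        by apply: Dm; apply: (cyl_match _ x0y).1; apply/codeP.
      move=> /nonsubset[x [/codeP xs /contrapT Dx]].
      by exists x.
    by exists x => // l; have := x0y l; have := xP l; rewrite /=; tauto.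
  have [d'y|d'y] := pselect (d' y).
    have [||x c'x xy] := fip c'; first exact: cc'.2.
      by move=> m my mc'; apply: nm'; exists m.
    by exists x.
  have [||x c'x xy] := fip (~` c'); first exact: open_closedC cc'.1.
    by move=> m my; rewrite setCK => mc'; apply: nm; exists m.
  by exists x.
Qed.

End one_step.
End back_and_forth.

(** * Homeomorphism of the complements of two P-sets *)

Section P_set_complements.
Variables (K : Type) (S : topologicalType).
Hypothesis Kinf : infinite_set [set: K].
Hypothesis Kpow : is_weak_power K K.
Hypothesis Scompact : compact [set: S].
Hypothesis Shaus : hausdorff_space S.
Hypothesis Sbase : has_clopen_base S.
Hypothesis Senum : clopen_enumerated K S.
Hypothesis Ssep : clopen_separation K S.
Hypothesis Ssplit : clopen_splitting K S.

(** A finite set of indices has a largest element, whose stage already matches all of them;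
    compactness passes to the whole family. *)
Lemma chain_match (L : Type) (lt : L -> L -> Prop) (c d : L -> set S) (x : S) :
  (forall a b e, lt a b -> lt b e -> lt a e) ->
  (forall a b, [\/ lt a b, a = b | lt b a]) ->
  (forall l, clopen (d l)) ->
  (forall m, exists y, (forall l, lt l m ->
    (c l x <-> d l y)) /\ (c m x <-> d m y)) ->
  exists y, forall l, c l x <-> d l y.
Proof.
move=> lt_trans lt_tri cd cdm.
have [|||y _ yP] := compact_fip Scompact (D := setT)
  (a := fun l => [set y | d l y <-> c l x]).
- exact: closedT.
- by move=> l; exact: (clopen_agree _ (cd l)).2.
- move=> s; have [->|s0] := eqVneq s fset0; first by exists x.
  have [m ms mP] := fset_max lt_trans lt_tri s0.
  have [y [ym my]] := cdm m; exists y => // l ls /=.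
  by have [->|/ym] := mP l ls; tauto.
- by exists y => l; have := yP l; rewrite /=; tauto.
Qed.

Lemma full_match (T T' : set S) : P_set K T -> P_set K T' ->
  exists (Om : Type) (c d : Om -> set S),
    [/\ forall a, [/\ clopen (c a), clopen (d a), forall x, T x -> ~ c a x &
          forall x, T' x -> ~ d a x],
      forall e, clopen e -> (forall x, T x -> ~ e x) -> exists a, c a = e,
      forall e, clopen e -> (forall x, T' x -> ~ e x) -> exists a, d a = e,
      forall x, exists y, forall a, c a x <-> d a y &
      forall y, exists x, forall a, c a x <-> d a y].
Proof.
move=> PT PT'.
have [Om [lt [lt_wf lt_trans lt_tri lt_seg KO]]] := initial_order K.
have [v vP] := Senum.
have [k0 _] := infinite_setN0 Kinf.
(* Stage [a] receives the task [u a]: a side, and the code of a clopen set that has to appear on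
   that side. *)
have [u uP] : exists u : Om -> bool * K, forall i, exists a, u a = i.
  apply: (cardinal_le_surj (true, k0)); apply: cardinal_le_trans KO.
  apply: cardinal_le_trans (prod_le Kinf Kpow).
  have [k1 k01] := infinite_neq k0 Kinf.
  apply/cardinal_leP; exists (fun z => (if z.1 then k0 else k1, z.2)).
  move=> [b k] [b' k'] /= [bb' ->]; congr pair.
  by case: b b' bb' => -[] // e; case: k01.
pose good (e : set S * set S) := [/\ clopen e.1, clopen e.2,
  forall x, T x -> ~ e.1 x & forall x, T' x -> ~ e.2 x].
pose task (a : Om) (e : set S * set S) := let w := v (u a).2 in
  if (u a).1 then clopen w -> (forall x, T x -> ~ w x) -> e.1 = w
  else clopen w -> (forall x, T' x -> ~ w x) -> e.2 = w.
pose Q (a : Om) (f : Om -> set S * set S) (e : set S * set S) :=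
  [/\ good e, task a e,
   forall x, exists y, (forall b, lt b a ->
     ((f b).1 x <-> (f b).2 y)) /\ (e.1 x <-> e.2 y) &
   forall y, exists x, (forall b, lt b a ->
     ((f b).1 x <-> (f b).2 y)) /\ (e.1 x <-> e.2 y)].
have [||f fP] := @wf_choice Om _ lt Q lt_wf (set0, set0).
- move=> a f g e fg [ge te forth back]; split=> // [x|y].
    have [y [yP exy]] := forth x; exists y; split=> // b ba.
    by rewrite -(fg b ba); exact: yP.
  have [x [xP exy]] := back y; exists x; split=> // b ba.
  by rewrite -(fg b ba); exact: xP.
- move=> a f fQ.
  pose L := {b | lt b a}; pose ltL (b b' : L) := lt (sval b) (sval b').
  have ltL_trans (b1 b2 b3 : L) : ltL b1 b2 -> ltL b2 b3 -> ltL b1 b3.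
    exact: lt_trans.
  have ltL_tri (b1 b2 : L) : [\/ ltL b1 b2, b1 = b2 | ltL b2 b1].
    have [|/sval_inj|] := lt_tri (sval b1) (sval b2);
      by [constructor 1|constructor 2|constructor 3].
  pose c (l : L) := (f (sval l)).1; pose d (l : L) := (f (sval l)).2.
  have gf (l : L) : good (f (sval l)) by have [] := fQ _ (svalP l).
  have cc l : clopen (c l) by have [] := gf l.
  have cd l : clopen (d l) by have [] := gf l.
  have cT l : forall x, T x -> ~ c l x by have [] := gf l.
  have dT l : forall x, T' x -> ~ d l x by have [] := gf l.
  have forth x : exists y, forall l, c l x <-> d l y.
    apply: (chain_match ltL_trans ltL_tri cd) => m.
    have [_ _ forth _] := fQ _ (svalP m); have [y [yP my]] := forth x.
    by exists y; split=> // l; exact: yP.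
  have back y : exists x, forall l, c l x <-> d l y.
    have [m|x xP] := @chain_match L ltL d c y ltL_trans ltL_tri cc.
      have [_ _ _ back] := fQ _ (svalP m); have [x [xP mx]] := back y.
      by exists x; split=> [l lm|]; apply: iff_sym => //; exact: xP.
    by exists x => l; exact: iff_sym.
  pose w := v (u a).2; have [ub|ub] := boolP (u a).1.
    (* If the clopen set of the task meets the P-set, the empty set takes its place. *)
    have [e [ce eT ew]] : exists e, [/\ clopen e, forall x, T x -> ~ e x &
        clopen w -> (forall x, T x -> ~ w x) -> e = w].
      have [[cw wT]|nw] := pselect (clopen w /\ forall x, T x -> ~ w x).
        by exists w.
      by exists set0; split=> [|x _ []|cw wT]; [exact: clopen0|case: nw].
    have [d' [cd' d'T' forth' back']] :=
      one_step Kinf Kpow Scompact Sbase Ssep Ssplit PT PT'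
        (lt_seg a) cc cd cT dT
        forth back ce eT.
    exists (e, d'); split=> //=; first by rewrite /task ub.
      move=> x; have [y [yP exy]] := forth' x; exists y; split=> // b ba.
      exact: (yP (exist _ b ba)).
    move=> y; have [x [xP exy]] := back' y; exists x; split=> // b ba.
    exact: (xP (exist _ b ba)).
  have [e [ce eT ew]] : exists e, [/\ clopen e, forall x, T' x -> ~ e x &
      clopen w -> (forall x, T' x -> ~ w x) -> e = w].
    have [[cw wT]|nw] := pselect (clopen w /\ forall x, T' x -> ~ w x).
      by exists w.
    by exists set0; split=> [|x _ []|cw wT]; [exact: clopen0|case: nw].
  (* For a task on the second side, the step is applied with the two sides exchanged. *)
  have [||c' [cc' c'T forth' back']] :=
    one_step Kinf Kpow Scompact Sbase Ssep Ssplit PT' PT (lt_seg a) cd cc dT cT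
      _ _ ce eT.
  + by move=> y; have [x xP] := back y; exists x => l; exact: iff_sym.
  + by move=> x; have [y yP] := forth x; exists y => l; exact: iff_sym.
  exists (c', e); split=> //=; first by rewrite /task (negbTE ub).
    move=> x; have [y [yP exy]] := back' x; exists y; split=> [b ba|].
      exact: iff_sym (yP (exist _ b ba)).
    exact: iff_sym.
  move=> y; have [x [xP exy]] := forth' y; exists x; split=> [b ba|].
    exact: iff_sym (xP (exist _ b ba)).
  exact: iff_sym.
have gf a : good (f a) by have [] := fP a.
exists Om, (fun a => (f a).1), (fun a => (f a).2); split=> //.
- move=> e ce eT; have [k vk] := vP e ce; have [a ua] := uP (true, k).
  exists a; have [_ + _ _] := fP a; rewrite /task ua /= vk.
  exact.
- move=> e ce eT; have [k vk] := vP e ce; have [a ua] := uP (false, k).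
  exists a; have [_ + _ _] := fP a; rewrite /task ua /= vk.
  exact.
- move=> x; apply: (@chain_match Om lt (fun a => (f a).1) (fun a =>
    (f a).2)) => //.
    by move=> a; have [] := gf a.
  by move=> m; have [_ _ ] := fP m.
- move=> y.
  have [| |x xP] := @chain_match Om lt (fun a => (f a).2) (fun a =>
    (f a).1) y lt_trans lt_tri.
  + by move=> a; have [] := gf a.
  + move=> m; have [_ _ _ /(_ y)[x [xP mx]]] := fP m.
    by exists x; split=> [l lm|]; apply: iff_sym => //; exact: xP.
  by exists x => l; exact: iff_sym.
Qed.

Lemma match_separated (Om : Type) (T : set S) (d : Om -> set S)
    (y z : S) : closed T ->
  (forall e, clopen e -> (forall x, T x -> ~ e x) -> exists a, d a = e) ->
  ~ T y -> (forall a, d a y <-> d a z) -> y = z.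
Proof.
move=> Tcl dE Ty yz; apply: contrapT => nyz.
have [||e [ce ey Te]] := @clopen_separated S Sbase y (T `|` [set z]).
- by apply: closedU => //; exact: closed_point.
- by move=> [].
have [a ea] : exists a, d a = e by apply: dE => // x Tx; apply: Te; left.
case: (Te z); first by right.
by move: ey; rewrite -ea => /yz.
Qed.

(** Small clopen neighbourhoods of [h x] miss [T'], hence are of the form [d a], and the preimage of
    [d a] under [h] is [c a]. *)
Lemma match_continuous (Om : Type) (T T' : set S) (c d : Om -> set S)
    (h : S -> S) (x : S) :
  closed T' -> (forall a, clopen (c a)) ->
  (forall e, clopen e -> (forall x, T' x -> ~ e x) -> exists a, d a = e) ->
  (forall x a, c a x <-> d a (h x)) -> ~ T' (h x) -> h @ x --> h x.
Proof.
move=> T'cl cc dE hE T'hx U /= Uhx.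
have : nbhs (h x) (U `&` ~` T').
  by apply: filterI => //; apply: open_nbhs_nbhs; split=> //;
    exact: closed_openC.
move=> /(clopen_nbhs Sbase)[e [ce ehx eU]].
have [a ea] : exists a, d a = e.
  by apply: dE => // z T'z /eU[].
have : nbhs x (c a).
  by apply: open_nbhs_nbhs; split; [exact: (cc a).1|apply/hE; rewrite ea].
by apply: filterS => z /hE; rewrite ea => /eU[].
Qed.

(** The matchings give [h] and [g] by choice. Points off a P-set are determined by the clopen sets
    missing it, so the two maps are mutually inverse there; their values on the P-sets are
    arbitrary. *)
Lemma P_set_complement_homeo (T T' : set S) : P_set K T -> P_set K T' ->
  exists h g : S -> S,
    (forall x, ~ T x -> [/\ ~ T' (h x), g (h x) = x & h @ x --> h x]) /\
    (forall y, ~ T' y -> [/\ ~ T (g y), h (g y) = y & g @ y --> g y]).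
Proof.
move=> PT PT'; have [Om [c [d [cdP cE dE forth back]]]] := full_match PT PT'.
have [Tcl _ _ _] := PT; have [T'cl _ _ _] := PT'.
have /choice[h hE] := forth; have /choice[g gE] := back.
have hT x : ~ T x -> ~ T' (h x).
  move=> Tx T'hx; have [e [ce ex Te]] := clopen_separated Sbase Tcl Tx.
  have [a ea] := cE e ce Te; have [_ _ _ /(_ _ T'hx)] := cdP a; apply.
  by apply/hE; rewrite ea.
have gT y : ~ T' y -> ~ T (g y).
  move=> T'y Tgy; have [e [ce ey Te]] := clopen_separated Sbase T'cl T'y.
  have [a ea] := dE e ce Te; have [_ _ /(_ _ Tgy) + _] := cdP a; apply.
  by apply/gE; rewrite ea.
exists h, g; split=> [x Tx|y T'y]; split.
- exact: hT.
- apply/esym; apply: (match_separated Tcl cE Tx) => a.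
  exact: iff_trans (hE x a) (iff_sym (gE (h x) a)).
- apply: (@match_continuous Om T T' c d h x) => // [a|];
    first by have [] := cdP a.
  exact: hT.
- exact: gT.
- apply/esym; apply: (match_separated T'cl dE T'y) => a.
  exact: iff_trans (iff_sym (gE y a)) (hE (g y) a).
- apply: (@match_continuous Om T' T d c g y) => // [a|z a|];
    first by have [] := cdP a.
    exact: iff_sym.
  exact: gT.
Qed.

End P_set_complements.

(** * Construction of P_kappa-points and of P-sets *)

Section P_sets.
Variables (K : Type) (S : topologicalType).
Hypothesis Kinf : infinite_set [set: K].
Hypothesis Kpow : is_weak_power K K.
Hypothesis Scompact : compact [set: S].
Hypothesis Shaus : hausdorff_space S.
Hypothesis Sbase : has_clopen_base S.
Hypothesis Senum : clopen_enumerated K S.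
Hypothesis Ssep : clopen_separation K S.
Hypothesis Ssplit : clopen_splitting K S.

Let small_unit : cardinal_lt unit K.
Proof. by apply: small_finite => //; exact: finite_finset. Qed.

Lemma point_not_open (x : S) : ~ open [set x].
Proof.
move=> ox; have cx : clopen [set x] by split=> //; exact: closed_point.
have [//|||c [d [_ [[y cy] [z dz]] /(_ tt) csub /(_ tt) dsub cd]]] :=
  @Ssplit unit (fun=> [set x]) x _ _ _ => //.
by apply: (cd x); [rewrite -(csub y cy)|rewrite -(dsub z dz)].
Qed.

Lemma P_point_P_set (p : S) : P_point K p -> P_set K [set p].
Proof.
move=> Pp; split; [exact: closed_point|by exists p|exact: point_not_open|].
move=> I c sI cc pc; have [|U Up UF] := Pp I c sI.
  by move=> i; apply: open_nbhs_nbhs; split; [exact: (cc i).1|exact: pc].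
have [e [ce ep eU]] := clopen_nbhs Sbase (open_nbhs_nbhs Up).
by exists e; split=> // [_ ->//|i x /eU/UF]; apply.
Qed.

Lemma P_set_setU1 (T : set S) (p : S) : P_set K T -> P_point K p -> ~ T p ->
  P_set K (T `|` [set p]).
Proof.
move=> [Tcl [x0 Tx0] _ TP] /P_point_P_set [_ _ _ pP] Tp; split.
- by apply: closedU => //; exact: closed_point.
- by exists x0; left.
- move=> oTp; apply: (@point_not_open p).
  suff -> : [set p] = (T `|` [set p]) `&` ~` T by apply: openI => //;
    exact: closed_openC.
  by apply/seteqP; split=> [_ ->|x [[]]//]; split=> //; right.
- move=> I c sI cc Tc.
  have [|e [ce Te ec]] := TP I c sI cc; first by move=> i x Tx; apply: Tc; left.
  have [|f [cf pf fc]] := pP I c sI cc; first by move=> i x px; apply: Tc;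
    right.
  exists (e `|` f); split; first exact: clopenU.
  - by move=> x [/Te|/pf]; [left|right].
  - by move=> i x [/ec|/fc]; exact.
Qed.

(** A decreasing sequence of length kappa of non-empty clopen sets decides every clopen set. It has
    a common point [p], at which it is a neighbourhood base, and small sets of stages are
    bounded. *)
Lemma P_point_exists (c0 : set S) : clopen c0 -> c0 !=set0 ->
  exists2 p, c0 p & P_point K p.
Proof.
move=> cc0 [x0 c0x0].
have [Om [lt [lt_wf lt_trans lt_tri lt_seg KO]]] := initial_order K.
have [v0 v0P] := Senum; have [k0 _] := infinite_setN0 Kinf.
have [u uP] := cardinal_le_surj k0 KO; pose v a := v0 (u a).
have vP c : clopen c -> exists a, v a = c.
  by move=> /v0P[k <-]; have [a <-] := uP k; exists a.
pose Q (a : Om) (f : Om -> set S) (d : set S) :=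
  [/\ clopen d, d !=set0, d `<=` c0, forall b, lt b a -> d `<=` f b &
      clopen (v a) -> d `<=` v a \/ d `<=` ~` v a].
have [||f fP] := @wf_choice Om _ lt Q lt_wf set0.
- move=> a f g d fg [cd d0 dc0 df dv]; split=> // b ba.
  by rewrite -(fg b ba); exact: df.
- move=> a f fQ; pose L := {b | lt b a}.
  have cf (l : L) : clopen (f (sval l)) by have [] := fQ _ (svalP l).
  have [|||x c0x fx] := compact_fip Scompact (D := c0)
    (a := fun l : L => f (sval l)).
  + exact: cc0.2.
  + by move=> l; exact: (cf l).2.
  + move=> s; have [->|s0] := eqVneq s fset0; first by exists x0.
    have [|b1 b2|m ms mP] :=
      @fset_max L (fun b1 b2 => lt (sval b1) (sval b2)) _ _ s s0.
    * by move=> b1 b2 b3; exact: lt_trans.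
    * have [|/sval_inj|] := lt_tri (sval b1) (sval b2);
        by [constructor 1|constructor 2|constructor 3].
    * have [_ [y my] mc0 mf _] := fQ _ (svalP m).
      exists y; first exact: mc0.
      by move=> l /mP[->//|lm]; exact: mf lm y my.
  have [|k|k|c [_ [[cc _] [[z cz] _] cs _ _]]] := @Ssplit (L + unit)%type
      (fun k => if k is inl l then f (sval l) else c0) x.
  + by apply: small_sum => //; exact: lt_seg.
  + by case: k.
  + by case: k.
  have cc0' : c `<=` c0 by exact: (cs (inr tt)).
  have cf' b : lt b a -> c `<=` f b by move=> ba;
    exact: (cs (inl (exist _ b ba))).
  have [cv|ncv] := pselect (clopen (v a)); last by exists c; split=> //;
    exists z.
  (* The side of [v a] is dictated by the point [z] of [c], which keeps the new set non-empty. *)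
  have [vz|vz] := pselect (v a z).
    exists (c `&` v a); split.
    * exact: clopenI.
    * by exists z.
    * by move=> t [/cc0'].
    * by move=> b ba t [/(cf' b ba)].
    * by move=> _; left=> t [].
  exists (c `\` v a); split.
  * exact: clopen_setD.
  * by exists z.
  * by move=> t [/cc0'].
  * by move=> b ba t [/(cf' b ba)].
  * by move=> _; right=> t [].
have [|||p c0p fp] := compact_fip Scompact (D := c0) (a := f).
- exact: cc0.2.
- by move=> a; have [[]] := fP a.
- move=> s; have [->|s0] := eqVneq s fset0; first by exists x0.
  have [m ms mP] := fset_max lt_trans lt_tri s0.
  have [_ [y my] mc0 mf _] := fP m; exists y; first exact: mc0.
  by move=> l /mP[->//|lm]; exact: mf lm y my.
exists p => // I F sI Fp.
(* A clopen neighbourhood of [p] is some [v a], and [f a] contains [p], so [f a] lies on the right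
   side of it. *)
have /choice[a aP] : forall i, exists a, f a `<=` F i.
  move=> i; have [e [ce ep eF]] := clopen_nbhs Sbase (Fp i).
  have [a va] := vP e ce; exists a; have [_ _ _ _] := fP a.
  rewrite va => /(_ ce)[fe|fe]; first exact: subset_trans eF.
  by case: (fe p (fp a)).
have [b ab] := small_bounded Kinf Kpow lt_tri lt_seg KO a sI.
have [cb _ _ bf _] := fP b; exists (f b); first by split; [exact: cb.1|].
by move=> x bx i _; apply: aP; exact: bf (ab i) _ bx.
Qed.

(* Either a family witnesses that [y] is in the closure of a small union of
   clopen sets, and then no small union disjoint from it accumulates at [y], or
   there is no such family at all. *)
Lemma small_union_avoidance (y : S) (c0 : set S) : clopen c0 -> ~ c0 y ->
  exists (L : Type) (u : L -> set S),
    [/\ cardinal_lt L K, forall l, clopen (u l), forall l, ~ u l y,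
      forall l x, u l x -> ~ c0 x &
      forall (J : Type) (a : J -> set S), cardinal_lt J K ->
        (forall j, clopen (a j)) -> (forall j, ~ a j y) ->
        (forall j l x, a j x -> ~ u l x) ->
      exists c, [/\ clopen c, ~ c y & forall j, a j `<=` c]].
Proof.
move=> cc0 c0y.
have [[L [u [sL cu uy nu]]]|nL] := pselect (exists (L : Type) (u : L -> set S),
    [/\ cardinal_lt L K, forall l, clopen (u l), forall l, ~ u l y &
      ~ exists c, [/\ clopen c, ~ c y & forall l, u l `<=` c]]).
  exists L, (fun l => u l `\` c0); split=> //.
  - by move=> l; exact: clopen_setD.
  - by move=> l [/uy].
  - by move=> l x [].
  - move=> J a sJ ca ay au.
    have [|j l x [ax c0x] ux|c [cc ac uc]] :=
      @Ssep J L (fun j => a j `\` c0) u sJ sL _ cu.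
    + by move=> j; exact: clopen_setD.
    + by apply: (au j l x ax).
    (* Otherwise the complement of [c] would contain all [u l] and miss [y], against [nu]. *)
    have cy : ~ c y.
      move=> cy; apply: nu; exists (~` c); split=> //.
      * by apply: clopenC => //; exact: set0.
    exists (c `|` c0); split; [exact: clopenU|by case|].
    move=> j x ax; have [c0x|c0x] := pselect (c0 x); first by right.
    by left; apply: (ac j); split.
exists void, (fun=> set0); split=> //.
- by apply: small_finite => //; exact: finite_finset.
- move=> J a sJ ca ay _; apply: contrapT => nc; apply: nL.
  by exists J, a; split.
Qed.

Lemma increasing_cover (Om : Type) (lt : Om -> Om -> Prop) (A : Om -> set S)
    (C : set S) (a0 : Om) :
  (forall a b c, lt a b -> lt b c -> lt a c) ->
  (forall a b, [\/ lt a b, a = b | lt b a]) ->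
  (forall a, open (A a)) -> (forall a b, lt a b -> A a `<=` A b) ->
  closed C -> C `<=` \bigcup_a A a -> exists a, C `<=` A a.
Proof.
move=> lt_trans lt_tri oA Ainc cC CA.
have [s sP] := closed_finite_cover Scompact cC oA CA.
have [s0|s0] := eqVneq s fset0.
  by exists a0 => x /sP[i]; rewrite s0 inE.
have [m ms mP] := fset_max lt_trans lt_tri s0.
by exists m => x /sP[i /mP[->//|im]]; exact: Ainc.
Qed.

(* [~` T] is an increasing union of clopen sets [A a], where beyond stage [a]
   nothing is added outside the [a]-th clopen neighbourhood of [y]. *)
Lemma P_set_neighborhood (y p : S) : y <> p ->
  exists T, [/\ P_set K T, T y, ~ T p & open (T `\ y)].
Proof.
move=> yp.
have [Om [lt [lt_wf lt_trans lt_tri lt_seg KO]]] := initial_order K.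
have [v0 v0P] := Senum; have [k0 _] := infinite_setN0 Kinf.
have [u0 u0P] := cardinal_le_surj k0 KO.
have [a0 _] := u0P k0.
(* The default [setT] makes every [V a] a clopen neighbourhood of [y]. *)
pose V a := if pselect (clopen (v0 (u0 a)) /\ v0 (u0 a) y) is left _
  then v0 (u0 a) else [set: S].
have cV a : clopen (V a).
  by rewrite /V; case: pselect => [[]|_] //; exact: clopenT.
have Vy a : V a y by rewrite /V; case: pselect => [[]|].
have VP c : clopen c -> c y -> exists a, V a = c.
  move=> cc cy; have [k kc] := v0P c cc; have [a ak] := u0P k.
  by exists a; rewrite /V ak kc; case: pselect => // -[].
have [c0 [cc0 c0p yc0]] := clopen_separated Sbase (closed_point Shaus (x := y))
  (fun py : p = y => yp (esym py)).
have {}yc0 : ~ c0 y by exact: yc0.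
have [L [u [sL cu uy uc0 uP]]] := small_union_avoidance cc0 yc0.
(* Each stage contains [c0], which keeps [p] out of [T], and avoids the family [u], so that [uP]
   encloses any small union of stages in a clopen set missing [y]. *)
pose Q (a : Om) (A : Om -> set S) (d : set S) :=
  [/\ clopen d /\ ~ d y, c0 `<=` d, forall l x, u l x -> ~ d x &
      forall b, lt b a -> [/\ A b `<=` d, d `\` V b `<=` A b & ~ (d `<=` A b)]].
have [||A AP] := @wf_choice Om _ lt Q lt_wf set0.
- move=> a f g d fg [cd dc0 du df]; split=> // b ba.
  by rewrite -(fg b ba); exact: df.
- move=> a A AQ; pose L0 := {b | lt b a}.
  have sL0 : cardinal_lt L0 K by exact: lt_seg.
  have QA (b : L0) := AQ (sval b) (svalP b).
  have cA (b : L0) : clopen (A (sval b)) by have [[]] := QA b.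
  (* The new stage has to contain the sets [P k] and to avoid the sets [N k]. *)
  pose P (k : L0 + unit) := if k is inl b then A (sval b) else c0.
  pose N (k : L0 + L) := match k with
    | inl b => ~` V (sval b) `\` A (sval b) | inr l => u l end.
  have cP k : clopen (P k) by case: k.
  have cN k : clopen (N k).
    case: k => [b|l] //=; apply: clopen_setD => //.
    by apply: clopenC => //; exact: set0.
  have Py k : ~ P k y by case: k => [b|_] //=; have [[]] := QA b.
  have Pu k l x : P k x -> ~ u l x.
    case: k => [b|_] /= kx ulx; last exact: uc0 ulx kx.
    by have [_ _ /(_ l x ulx)] := QA b.
  have PN k k' x : P k x -> ~ N k' x.
    case: k' => [b'|l]; last exact: Pu.
    case: k => [b|_] /= kx [Vx]; last first.
      by apply; have [_ c0A _ _] := QA b'; exact: c0A.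
    apply; have [bb'|bb'|b'b] := lt_tri (sval b) (sval b').
    + by have [_ _ _ /(_ _ bb')[AA _ _]] := QA b'; exact: AA.
    + by rewrite -bb'.
    + by have [_ _ _ /(_ _ b'b)[_ AA _]] := QA b; exact: AA.
  have sP : cardinal_lt (L0 + unit)%type K by exact: small_sum.
  have sN : cardinal_lt (L0 + L)%type K by exact: small_sum.
  have [c [cc cy Pc]] := uP _ P sP cP Py Pu.
  have [e [ce Pe Ne]] := Ssep sP sN cP cN PN.
  pose D := c `&` e.
  have cD : clopen D by exact: clopenI.
  (* For strict growth a piece near [y] is added, inside all earlier [V b] and off [u] and [D]. Of
     two disjoint such pieces, one misses [y]. *)
  pose G (k : (L0 + L) + unit) := match k with
    | inl (inl b) => V (sval b) | inl (inr l) => ~` u l | inr _ => ~` D end.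
  have [|k|k|d1 [d2 [[cd1 cd2] [d1n d2n] d1G d2G d12]]] := @Ssplit _ G y.
  + exact: small_sum.
  + case: k => [[b|l]|_] //=; apply: clopenC => //; exact: set0.
  + by case: k => [[b|l]|_] //= -[/cy].
  have [n [cn [z nz] nG ny]] : exists n, [/\ clopen n, n !=set0,
      forall k, n `<=` G k & ~ n y].
    have [d1y|d1y] := pselect (d1 y); last by exists d1.
    by exists d2; split=> //; exact: d12.
  exists (D `|` n); split.
  + split; first exact: clopenU.
    by case=> // -[/cy].
  + by move=> x c0x; left; split; [exact: (Pc (inr tt))|exact: (Pe (inr tt))].
  + move=> l x ulx [[_ ex]|nx]; first exact: (Ne (inr l) x).
    exact: (nG (inl (inr l)) x nx).
  + move=> b ba; pose l : L0 := exist _ b ba; split.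
    * by move=> x Ax; left; split; [exact: (Pc (inl l))|exact: (Pe (inl l))].
    * move=> x [[[_ ex]|nx] Vx].
        by apply: contrapT => Ax; apply: (Ne (inl l) x) => //; split.
      by case: Vx; exact: (nG (inl (inl l))).
    * move=> /(_ z (or_intror nz)) Az; apply: (nG (inr tt) z nz).
      by split; [exact: (Pc (inl l))|exact: (Pe (inl l))].
have cA a : clopen (A a) by have [[]] := AP a.
have Ainc a b : lt a b -> A a `<=` A b.
  by move=> ab; have [_ _ _ /(_ a ab)[]] := AP b.
have AV a b x : A b x -> ~ V a x -> A a x.
  move=> Abx Vx; have [ab|->//|ba] := lt_tri a b; last exact: Ainc ba _ Abx.
  by have [_ _ _ /(_ a ab)[_ + _]] := AP b; apply.
have oA : open (\bigcup_a A a) by apply: bigcup_open => a _; exact: (cA a).1.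
have cover C : closed C -> C `<=` \bigcup_a A a -> exists a, C `<=` A a.
  by apply: increasing_cover a0 lt_trans lt_tri _ Ainc => a; exact: (cA a).1.
exists (~` \bigcup_a A a); split.
- split.
  + exact: open_closedC.
  + by exists y => -[a _]; have [[]] := AP a.
  (* If [T] were open, its complement would be closed and hence contained in one stage,
     contradicting strict growth. *)
  + move=> /open_closedC; rewrite setCK => cA'.
    have [a Aa] := cover _ cA' (fun x => id).
    have [b ab] := small_bounded Kinf Kpow lt_tri lt_seg KO (fun _ : unit =>
      a) small_unit.
    have [_ _ _ /(_ a (ab tt))[_ _]] := AP b; apply=> x bx; apply: Aa.
    by exists b.
  + move=> I c sI cc Tc.
    have /choice[a aP] : forall i, exists a, ~` c i `<=` A a.
      move=> i; apply: cover; first exact: open_closedC (cc i).1.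
      by move=> x cx; apply: contrapT => nA; exact: cx (Tc i x nA).
    have [b ab] := small_bounded Kinf Kpow lt_tri lt_seg KO a sI.
    exists (~` A b); split.
    * by apply: clopenC => //; exact: set0.
    * by move=> x nA bx; apply: nA; exists b.
    * move=> i x bx; apply: contrapT => /aP ax; apply: bx.
      exact: Ainc (ab i) _ ax.
- by move=> [a _]; have [[]] := AP a.
- by apply; exists a0 => //; have [_ + _ _] := AP a0; apply.
(* A point outside [V a] not yet in [A a] is never added later, and every point other than [y] lies
   outside some [V a]. *)
- have -> : (~` \bigcup_a A a) `\ y = \bigcup_a (~` V a `\` A a).
    apply/seteqP; split=> [x [nA xy]|x [a _ [Vx Ax]]].
      have [e [ce ey ne]] := clopen_separated Sbase (closed_point Shaus
        (x := x))
        (fun yx : y = x => xy (esym yx)).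
      have [a Va] := VP e ce ey; exists a => //; split.
        by rewrite Va => ex; exact: ne ex.
      by move=> Ax; apply: nA; exists a.
    split=> [[b _ Abx]|xy]; first by apply: Ax; exact: AV Abx Vx.
    by apply: Vx; rewrite xy; exact: Vy.
  apply: bigcup_open => a _.
  have cC : clopen (~` V a) by apply: clopenC => //; exact: set0.
  exact: (clopen_setD cC (cA a)).1.
Qed.

End P_sets.

(** * Homeomorphisms between subspaces through self-maps *)

Lemma homeomorphic_sym (X Y : topologicalType) : homeomorphic X Y ->
  homeomorphic Y X.
Proof. by move=> [f [g [cf cg fg gf]]]; exists g, f. Qed.

Lemma homeomorphic_trans (Y X Z : topologicalType) :
  homeomorphic X Y -> homeomorphic Y Z -> homeomorphic X Z.
Proof.
move=> [f [g [cf cg fg gf]]] [f' [g' [cf' cg' fg' gf']]].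
exists (f' \o f), (g \o g'); split.
- by move=> x; apply: continuous_comp; [exact: cf|exact: cf'].
- by move=> x; apply: continuous_comp; [exact: cg'|exact: cg].
- exact: can_comp.
- exact: can_comp.
Qed.

(** A topological embedding with image [D]. It lets a card, and a card of a card, be handled as
    subsets of the same space [S]. *)
Definition embeds_onto (Y S : topologicalType) (e : Y -> S)
    (D : set S) : Prop :=
  [/\ injective e, range e = D, continuous e &
      forall y U, nbhs y U ->
        exists2 V, nbhs (e y) V & forall z, V (e z) -> U z].

Lemma embeds_homeomorphic (S Y1 Y2 : topologicalType)
    (e1 : Y1 -> S) (e2 : Y2 -> S)
    (D1 D2 : set S) (h g : S -> S) :
  embeds_onto e1 D1 -> embeds_onto e2 D2 ->
  (forall x, D1 x -> [/\ D2 (h x), g (h x) = x & h @ x --> h x]) ->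
  (forall x, D2 x -> [/\ D1 (g x), h (g x) = x & g @ x --> g x]) ->
  homeomorphic Y1 Y2.
Proof.
move=> [i1 r1 c1 n1] [i2 r2 c2 n2] hP gP.
have D1e y : D1 (e1 y) by rewrite -r1; exists y.
have D2e y : D2 (e2 y) by rewrite -r2; exists y.
have /choice[f fE] : forall y1, exists y2, e2 y2 = h (e1 y1).
  by move=> y1; have [+ _ _] := hP _ (D1e y1); rewrite -r2 => -[y2 _ <-];
    exists y2.
have /choice[k kE] : forall y2, exists y1, e1 y1 = g (e2 y2).
  by move=> y2; have [+ _ _] := gP _ (D2e y2); rewrite -r1 => -[y1 _ <-];
    exists y1.
exists f, k; split.
- move=> y U /n2[V]; rewrite fE => hV VU.
  have [_ _ /(_ V hV) /= yV] := hP _ (D1e y).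
  change (nbhs y (f @^-1` U));
    move: (c1 y _ yV : nbhs y (e1 @^-1` (h @^-1` V)));
      apply: filterS => z /= zV.
  by apply: VU; rewrite fE.
- move=> y U /n1[V]; rewrite kE => gV VU.
  have [_ _ /(_ V gV) /= yV] := gP _ (D2e y).
  change (nbhs y (k @^-1` U));
    move: (c2 y _ yV : nbhs y (e2 @^-1` (g @^-1` V)));
      apply: filterS => z /= zV.
  by apply: VU; rewrite kE.
- by move=> y; apply: i1; rewrite kE fE; have [] := hP _ (D1e y).
- by move=> y; apply: i2; rewrite fE kE; have [] := gP _ (D2e y).
Qed.

Lemma remove_point_neq (S : topologicalType) (p : S)
  (y : remove_point p) : val y <> p.
Proof. exact: (@set_valP _ [set~ p] y). Qed.

Lemma remove_point_lift (S : topologicalType) (p z : S) : z <> p ->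
  exists y : remove_point p, val y = z.
Proof. by move=> zp; exists (SigSub (mem_set (zp : [set~ p] z))). Qed.

Lemma remove_point_embeds (S : topologicalType) (p : S) :
  @embeds_onto (remove_point p) S val [set~ p].
Proof.
split.
- exact: val_inj.
- apply/seteqP; split=> [_ [y _ <-]|x xp]; first exact: remove_point_neq.
  by have [y yx] := remove_point_lift xp; exists y.
- exact: initial_continuous.
- move=> y U; rewrite nbhsE => -[W [[V oV VW] Wy] WU].
  exists V; first by apply: open_nbhs_nbhs; split=> //; move: Wy; rewrite -VW.
  by move=> z Vz; apply: WU; rewrite -VW.
Qed.

Lemma remove_point2_embeds (S : topologicalType) (p : S) (x : remove_point p) :
  @embeds_onto (remove_point x) S (fun y => val (val y))
    [set z | z <> val x /\ z <> p].
Proof.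
have [i1 r1 c1 n1] := remove_point_embeds p.
have [i2 r2 c2 n2] := remove_point_embeds x.
split.
- by move=> y z /i1/i2.
- apply/seteqP; split=> [_ [y _ <-]|z [zx zp]].
    by split; [move=> /i1; exact: remove_point_neq|exact: remove_point_neq].
  have [z' z'z] := remove_point_lift zp.
  have [|z'' z''z] := @remove_point_lift _ x z'; last by exists z'';
    rewrite ?z''z.
  by move=> z'x; apply: zx; rewrite -z'z z'x.
- move=> y; exact: (continuous_comp (c2 y) (c1 (val y))).
- move=> y U /n2[V /n1[W yW WV] VU]; exists W => // z Wz.
  by apply: VU; exact: WV.
Qed.

Lemma cvg_at_eq (S : topologicalType) (h k : S -> S) (N : set S) (z : S) :
  nbhs z N -> (forall x, N x -> h x = k x) -> k @ z --> k z -> h @ z --> h z.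
Proof.
move=> zN hk kz U; rewrite hk; last exact: nbhs_singleton.
move=> /kz /= zU; change (nbhs z (h @^-1` U)).
have : nbhs z (N `&` k @^-1` U) by exact: filterI.
by apply: filterS => x [Nx kx]; rewrite /= hk.
Qed.

(** * The cards of the Parovicenko space *)

Section Parovicenko_cards.
Variables (R : realType) (K : Type).
Hypothesis Kinf : infinite_set [set: K].
Hypothesis Kpow : is_weak_power K K.
Variable S : topologicalType.
Hypothesis hS : Parovicenko R K S.

Let Scompact := Parovicenko_compact hS.
Let Shaus := Parovicenko_hausdorff hS.
Let Sbase := Parovicenko_clopen_base hS.
Let Senum := Parovicenko_enumerated Kinf Kpow hS.
Let Ssep := Parovicenko_separation Kinf Kpow hS.
Let Ssplit := Parovicenko_splitting hS.

Lemma P_points_exchange (p q : S) : P_point K p -> P_point K q ->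
  homeomorphic (remove_point p) (remove_point q).
Proof.
move=> /(P_point_P_set Kinf Shaus Sbase Ssplit) Pp.
move=> /(P_point_P_set Kinf Shaus Sbase Ssplit) Pq.
have [h [g [hP gP]]] := P_set_complement_homeo Kinf Kpow Scompact Shaus Sbase
  Senum Ssep Ssplit Pp Pq.
by apply: embeds_homeomorphic hP gP; exact: remove_point_embeds.
Qed.

(** With [T] closed and [T] minus [val x] open, the identity on the latter and a homeomorphism off
    [T] live on disjoint open sets, so their union is continuous. *)
Lemma remove_P_point (p : S) (x : remove_point p) : P_point K p ->
  homeomorphic (remove_point (val x)) (remove_point x).
Proof.
move=> Pp; have xp : val x <> p by exact: remove_point_neq.
have [T [PT Tx Tp oT]] := P_set_neighborhood Kinf Kpow Scompact Shaus Sbase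
  Senum Ssep Ssplit xp.
have PTp := P_set_setU1 Kinf Shaus Sbase Ssplit PT Pp Tp.
have [h [g [hP gP]]] := P_set_complement_homeo Kinf Kpow Scompact Shaus Sbase
  Senum Ssep Ssplit PT PTp.
have [Tcl _ _ _] := PT.
pose glue (k : S -> S) z := if pselect (T z) is left _ then z else k z.
have glueT k z : T z -> glue k z = z by rewrite /glue; case: pselect.
have glueN k z : ~ T z -> glue k z = k z by rewrite /glue; case: pselect.
have glue_cvgT (k : S -> S) z : T z -> z <> val x -> glue k @ z --> glue k z.
  move=> Tz zx; apply: (@cvg_at_eq _ _ id (T `\ val x)); last exact: cvg_id.
    by apply: open_nbhs_nbhs.
  by move=> t [Tt _]; exact: glueT.
have glue_cvgN (k : S -> S) z : ~ T z -> k @ z --> k z ->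
  glue k @ z --> glue k z.
  move=> Tz; apply: (@cvg_at_eq _ _ _ (~` T)); last exact: glueN.
  by apply: open_nbhs_nbhs; split=> //; exact: closed_openC.
apply: (embeds_homeomorphic (remove_point_embeds _) (remove_point2_embeds x)
  (h := glue h) (g := glue g)) => z.
- move=> zx; have [Tz|Tz] := pselect (T z).
    rewrite !glueT //; split=> //; last by have := glue_cvgT h z Tz zx;
      rewrite glueT.
    by split=> // zp; apply: Tp; rewrite -zp.
  have [hT ghz hz] := hP z Tz; rewrite glueN //.
  have hTz : ~ T (h z) by move=> hTz; apply: hT; left.
  rewrite glueN //; split=> //; last by have := glue_cvgN h z Tz hz;
    rewrite glueN.
  by split=> [hx|hp]; [apply: hTz; rewrite hx|apply: hT; right].
- move=> [zx zp]; have [Tz|Tz] := pselect (T z).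
    by rewrite !glueT //; split=> //; have := glue_cvgT g z Tz zx;
      rewrite glueT.
  have [gT hgz gz] : [/\ ~ T (g z), h (g z) = z & g @ z --> g z].
    by apply: gP => -[].
  rewrite glueN // glueN //; split=> //; last first.
    by have := glue_cvgN g z Tz gz; rewrite glueN.
  by move=> gx; apply: gT; rewrite gx.
Qed.

Lemma P_point_reconstruction (p : S) : P_point K p ->
  reconstruction S (remove_point p).
Proof.
move=> Pp Y; split=> [[x Yx]|[x Yx]]; last first.
  exists (val x); apply: homeomorphic_trans Yx _; apply: homeomorphic_sym.
  exact: remove_P_point.
have [xp|xp] := pselect (x = p); last first.
  have [x' x'x] := remove_point_lift xp; exists x';
    apply: homeomorphic_trans (remove_P_point x' Pp).
  by rewrite x'x.
(* The card at [p] itself needs another P-point [q]: removing [p], removing [q], and removing both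
   then give the same space. *)
have [q qp Pq] : exists2 q, q <> p & P_point K q.
  have [y _ yp] := @nonisolated R K S hS p setT filterT.
  have [c [cc cy cp]] := clopen_separated Sbase (closed_point Shaus
    (x := p)) yp.
  have [|q cq Pq] := P_point_exists Kinf Kpow Scompact Sbase Senum Ssplit cc;
    first by exists y.
  by exists q => // qp; apply: (cp p) => //; rewrite -qp.
have [q' q'q] := remove_point_lift qp; exists q'.
apply: homeomorphic_trans (remove_P_point q' Pp); rewrite q'q.
apply: homeomorphic_trans Yx _; rewrite xp; exact: P_points_exchange.
Qed.

(** A compact complement of [p] would be closed, and [p] would be isolated. *)
Lemma remove_P_point_not_compact (p : S) : ~ homeomorphic (remove_point p) S.
Proof.
move=> [f [g [cf cg fg gf]]].
have [_ _ cval _] := remove_point_embeds p.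
apply: (point_not_open Kinf Shaus Ssplit (x := p)).
have -> : [set p] = ~` ((fun s => val (g s)) @` [set: S]).
  rewrite -[LHS]setCK; congr (~` _).
  apply/seteqP; split=> [z zp|_ [s _ <-]]; last exact: remove_point_neq.
  by have [y <-] := remove_point_lift zp; exists (f y) => //; rewrite fg.
apply: closed_openC; apply: compact_closed => //.
apply: continuous_compact => //; apply: continuous_subspaceT => s.
exact: (continuous_comp (cg s) (cval (g s))).
Qed.

End Parovicenko_cards.

(* [R] is the field of real numbers; [K] has cardinality kappa. *)
Theorem theorem6p7 (R : realType) (K : Type)
    (Kinf : infinite_set [set: K]) (Kpow : is_weak_power K K)
    (S : topologicalType) (hS : Parovicenko R K S) :
  ~ reconstructible S /\
  (forall p : S, P_point K p ->
     reconstruction S (remove_point p) /\ ~ homeomorphic (remove_point p) S).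
Proof.
have main (p : S) : P_point K p ->
    reconstruction S (remove_point p) /\ ~ homeomorphic (remove_point p) S.
  move=> Pp; split; first exact: (P_point_reconstruction Kinf Kpow hS Pp).
  exact: (remove_P_point_not_compact Kinf hS).
split=> // rS; have [x] := Parovicenko_nonempty Kinf hS.
have [|p _ Pp] := P_point_exists Kinf Kpow (Parovicenko_compact hS)
  (Parovicenko_clopen_base hS)
  (Parovicenko_enumerated Kinf Kpow hS) (Parovicenko_splitting hS) clopenT.
  by exists x.
have [rec nhomeo] := main p Pp; apply: nhomeo; apply: homeomorphic_sym.
exact: rS.
Qed.
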